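(* Let $r\ge 0$ be an integer. The number of vertices of the ball $D_{r+1}$ in $H^2_8$ minus the number of black triangles with all vertices in $D_{r+1}$ equals $|\partial D_{r+1}|/2+1$, and this is the dimension of the real vector space of d-holomorphic functions in $D_{r+1}$. Moreover, the number of values on the boundary $\partial D_{r+1}$ needed to reconstruct a d-holomorphic function in $D_{r+1}$ is equal to $|\partial D_{r+1}|/2+1$: there is a set of $|\partial D_{r+1}|/2+1$ vertices of $\partial D_{r+1}$ such that every d-holomorphic function in $D_{r+1}$ is uniquely determined by its values on this set, and no smaller set of vertices of $\partial D_{r+1}$ has this property.
   Context: $H^2_8$ denotes the (unique up to isomorphism) locally finite triangulation of the plane in which every vertex belongs to exactly $8$ edges (equivalently, $8$ triangles), with its triangles coloured black and white so that any two triangles sharing an edge have opposite colours. The distance between vertices is the minimal number of edges joining them. Fix a vertex $0$. $D_r$ is the set of vertices at distance at most $r$ from $0$, $\partial D_r$ is the set of vertices at distance exactly $r$ from $0$, and $|\partial D_r|$ is its number of vertices. A d-holomorphic function in $D_{r+1}$ is a function $\psi:D_{r+1}\to\mathbb{R}$ such that for every black triangle $T$ with all three vertices in $D_{r+1}$ one has $\sum_{P\in T}\psi(P)=0$, the sum being over the vertices $P$ of $T$. *)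

(* Defs.v *)
(* Mathematical Components and MathComp-Analysis. *)
From HB Require Import structures.
From mathcomp Require Import all_boot all_order all_algebra finmap.
From mathcomp Require Import all_classical all_reals all_analysis.

Set Implicit Arguments.
Unset Strict Implicit.
Unset Printing Implicit Defensive.

Import Order.TTheory GRing.Theory Num.Theory.
Import numFieldNormedType.Exports.

Local Open Scope classical_set_scope.
Local Open Scope card_scope.
Local Open Scope ring_scope.

Section Complex.
Variables (R : realType) (V : choiceType).

(* The simplices have at most three vertices, so the complex consists of
   vertices, edges and triangles; every element of V is a vertex. *)
Record simplicial_2complex (K : set {fset V}) : Prop := {
  sc_vertex : forall v : V, K [fset v]%fset;
  sc_nonempty : forall s, K s -> s != fset0;
  sc_face : forall s t : {fset V}, K s -> (t `<=` s)%fset -> t != fset0 -> K t;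
  sc_dim : forall s, K s -> (#|` s| <= 3)%N
}.

Definition edge (K : set {fset V}) : set {fset V} :=
  [set s | K s /\ #|` s| = 2%N].

Definition triangle (K : set {fset V}) : set {fset V} :=
  [set s | K s /\ #|` s| = 3%N].

(* The geometric realization, in barycentric coordinates. It carries the
   topology of pointwise convergence, which for a locally finite complex is
   the same as the weak topology determined by the simplices. *)
Definition realization (K : set {fset V}) : set {ptws V -> R} :=
  [set x | (forall v, 0 <= x v) /\
    exists s, [/\ K s, forall v, v \notin s -> x v = 0 &
                 \sum_(v <- s) x v = 1]].

Definition homeomorphic_to_plane (A : set {ptws V -> R}) : Prop :=
  exists (f : {ptws V -> R} -> R * R) (g : R * R -> {ptws V -> R}),
    [/\ {within A, continuous f}, continuous g,
        forall p, A (g p),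
        forall p, f (g p) = p &
        forall x, A x -> g (f x) = x].

Definition triangulates_plane (K : set {fset V}) : Prop :=
  simplicial_2complex K /\ homeomorphic_to_plane (realization K).

(* [black s] is the colour of the triangle [s]: black if true, white if false;
   its values on other finite sets are irrelevant. Local finiteness follows
   from [H28_edges] and [H28_triangles]. *)
Record is_H28 (K : set {fset V}) (black : {fset V} -> bool) : Prop := {
  H28_plane : triangulates_plane K;
  H28_edges : forall v, [set e | edge K e /\ v \in e] #= `I_8;
  H28_triangles : forall v, [set t | triangle K t /\ v \in t] #= `I_8;
  H28_colour : forall s t, triangle K s -> triangle K t ->
    #|` (s `&` t)%fset| = 2%N -> black s = ~~ black t
}.

Fixpoint walk (K : set {fset V}) (n : nat) (u v : V) : Prop :=
  if n is m.+1 then exists2 w, edge K [fset u; w]%fset & walk K m w v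
  else u = v.

Definition at_distance (K : set {fset V}) (u v : V) (n : nat) : Prop :=
  walk K n u v /\ forall m, walk K m u v -> (n <= m)%N.

Definition disc_set (K : set {fset V}) (o : V) (r : nat) : set V :=
  [set v | exists2 n, (n <= r)%N & at_distance K o v n].

(* [fset_set] is the empty set on infinite sets; [finite_disc_set] below shows
   that this does not occur here, and the two sets defined next are then
   finite as well. *)
Definition disc (K : set {fset V}) (o : V) (r : nat) : {fset V} :=
  fset_set (disc_set K o r).

Definition boundary (K : set {fset V}) (o : V) (r : nat) : {fset V} :=
  fset_set [set v | at_distance K o v r].

Definition black_triangles (K : set {fset V}) (black : {fset V} -> bool)
    (D : {fset V}) : {fset {fset V}} :=
  fset_set [set t | [/\ triangle K t, black t & (t `<=` D)%fset]].

Definition d_holomorphic (K : set {fset V}) (black : {fset V} -> bool)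
    (D : {fset V}) (psi : {ffun D -> R^o}) : Prop :=
  forall t : {fset V}, triangle K t -> black t -> (t `<=` D)%fset ->
    \sum_(P : D | val P \in t) psi P = 0.

(* Every d-holomorphic function in D is uniquely determined by its values
   on S. *)
Definition determining (K : set {fset V}) (black : {fset V} -> bool)
    (D S : {fset V}) : Prop :=
  forall psi phi : {ffun D -> R^o},
    d_holomorphic K black psi -> d_holomorphic K black phi ->
    (forall P : D, val P \in S -> psi P = phi P) -> psi = phi.

Lemma finite_disc_set K black o r : is_H28 K black ->
  finite_set (disc_set K o r).
Proof.
move=> H; pose W n u := [set v | walk K n u v].
have finW n : forall u, finite_set (W n u).
  elim: n => [|n IHn] u.
    by apply: (sub_finite_set _ (finite_set1 u)) => v /= ->.
  pose N := \bigcup_(e in [set e | edge K e /\ u \in e]) [set` e].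
  have finN : finite_set N.
    apply: bigcup_finite => [|e _]; last exact: finite_fset.
    by exists 8%N; exact: (H28_edges H).
  have : finite_set (\bigcup_(w in N) W n w).
    by apply: bigcup_finite => // w _; exact: IHn.
  apply: sub_finite_set => v /= [w euw wv]; exists w => //.
  by exists [fset u; w]%fset => /=; rewrite ?inE ?eqxx ?orbT.
have : finite_set (\bigcup_(n in `I_r.+1) W n o).
  by apply: bigcup_finite => // n _; exact: finW.
by apply: sub_finite_set => v [n nr [wv _]]; exists n.
Qed.

Lemma finite_at_distance K black o r : is_H28 K black ->
  finite_set [set v | at_distance K o v r].
Proof.
move=> /(@finite_disc_set _ _ o r); apply: sub_finite_set => v /= dv.
by exists r.
Qed.

Lemma finite_black_triangles K black (D : {fset V}) :
  finite_set [set t | [/\ triangle K t, black t & (t `<=` D)%fset]].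
Proof.
apply: (sub_finite_set _ (finite_fset (fpowerset D))) => t [_ _ tD] /=.
by rewrite fpowersetE.
Qed.

End Complex.

(* Main.v *)
(* A homeomorphism with the plane enters only through two facts: a flat bundle with discrete
   fibres over the vertices of [K] has a section (simple connectivity), and removing a vertex does
   not disconnect [K] (no cut points). Counting and the colouring show that every edge lies in one
   black and one white triangle; the absence of cut vertices makes every link an 8-cycle. A
   combinatorial model of the tessellation, with vertices the words of an odometer, carries
   involutions with the relations satisfied by the darts of [K]; a section of the resulting bundle
   maps the darts of [K] to those of the model, compatibly with all involutions. Reading off the
   lengths of the words gives the distance to the root and, around each vertex, the cyclic
   arrangement of parents, siblings and children.
   Given this local picture, each black triangle has exactly two radial edges and each radial edge
   lies in one black triangle, which gives the count. The constraints are independent since every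
   black triangle has a vertex lying in no other black triangle of the same or lower height. The
   whole boundary determines the function since every inner vertex lies in a black triangle whose
   other two vertices are one step further out; a minimal determining part of the boundary has as
   many vertices as the dimension. *)
Require Import Defs.
From HB Require Import structures.
From mathcomp Require Import all_boot all_order all_algebra finmap.
From mathcomp Require Import all_classical all_reals all_analysis.
From mathcomp Require Import zify ring lra.

Set Implicit Arguments.
Unset Strict Implicit.
Unset Printing Implicit Defensive.

Import Order.TTheory GRing.Theory Num.Theory.
Import numFieldNormedType.Exports.

Local Open Scope ring_scope.

(** * Flat sections over the line and the plane *)

(** The hypotheses give [K] neither an orientation nor a cyclic order around its vertices, so a
    rotation cannot be carried from the model to [K] directly. The colouring is the substitute:
    replacing the end of a dart by the third vertex of the triangle of a given colour is an
    involution, and the two colours together walk around a link. The relations to be checked say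
    that a triangle closes up after three steps and a link after eight. The colour bit given to one
    dart amounts to the choice of an orientation. Injectivity of the developing map is bypassed.
    Only levels and numbers of parents are pulled back from the words; that [o] is the single vertex
    of level zero follows because the end of the descent through first parents is the same for
    adjacent vertices. The constants of the model come from the degree: off the root there are two
    neighbours on the same circle and one or two parents, which leaves five or four children, the
    last of them owned by the next vertex. The constraints are triangular because two neighbouring
    children of one vertex never both have two parents. *)

Lemma locally_constant_segment (R : realType) (a b : R) (P : R -> Prop) :
  a <= b ->
  (forall t, a <= t <= b -> exists2 e : R, 0 < e &
     forall t', a <= t' <= b -> `|t' - t| < e -> (P t' <-> P t)) ->
  P a -> P b.
Proof.
move=> ab loc Pa.
pose S : set R := fun t => a <= t <= b /\ forall t', a <= t' <= t -> P t'.
have Sa : S a.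
  split=> [|t' /andP[h1 h2]]; first by rewrite lexx ab.
  by have -> : t' = a by apply/le_anti; rewrite h2 h1.
have Sb : ubound S b by move=> t [/andP[_ ?] _].
have hS : has_sup S by split; [exists a | exists b].
set s := sup S.
have as_ : a <= s by apply: ub_le_sup => //; exists b.
have sb : s <= b by apply: ge_sup => //; exists a.
have [e e0 he] := loc s (introT andP (conj as_ sb)).
have [t [/andP[at_ tb] Pt] st] := sup_adherent e0 hS.
have ts : t <= s.
  apply: ub_le_sup; first by exists b.
  by split => //; rewrite at_ tb.
have Ps : P s.
  have hts : `|t - s| < e by rewrite distrC ger0_norm ?subr_ge0 //; rewrite /s in st *; lra.
  by apply/(he t); rewrite ?at_ ?tb //; apply: Pt; rewrite at_ lexx.
have [bs|bs] := lerP b s; first by have -> : b = s by apply/le_anti; rewrite bs sb.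
(* If [s < b], then [P] still holds up to [u], which lies beyond the supremum. *)
pose u := Num.min b (s + e / 2).
have su : s < u by rewrite /u lt_min bs /=; lra.
suff Su : S u.
  have : u <= s by apply: ub_le_sup => //; exists b.
  by rewrite leNgt su.
have ub : u <= b by rewrite /u ge_min lexx.
have use : u <= s + e / 2 by rewrite /u ge_min lexx orbT.
split=> [|t' /andP[at' t'u]]; first by rewrite ub andbT (le_trans as_ (ltW su)).
have [t't|tt'] := lerP t' t; first by apply: Pt; rewrite at' t't.
apply/(he t') => //; first by rewrite at' (le_trans t'u).
move: st t'u use tt'; rewrite -/s ltr_norml => {su ub} *; apply/andP; split; lra.
Qed.

Section LineConnection.
Context {R : realType} {X : Type}.
Implicit Types (T : R -> R -> X -> X) (eps : R -> R) (h : R -> X).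

(** The asymmetry comes from the application: nearby points have larger carriers, so when [r] is
    close to both [s] and [t], the vertices chosen for the three points all lie in the carrier of
    [r]. *)
Record line_connection T eps : Prop := {
  lc_pos : forall t, 0 < eps t;
  lc_id : forall t x, T t t x = x;
  lc_inv : forall s t x, `|t - s| < eps s -> T t s (T s t x) = x;
  lc_comp : forall s t r x, `|r - s| < eps s -> `|r - t| < eps t ->
    T t r (T s t x) = T s r x
}.

Definition flat_on T h (a b : R) := forall t, a <= t <= b -> exists2 d : R, 0 < d &
  forall t', a <= t' <= b -> `|t' - t| < d -> h t' = T t t' (h t).

Lemma flat_on_sub T h (a b a' b' : R) : a <= a' -> b' <= b ->
  flat_on T h a b -> flat_on T h a' b'.
Proof.
move=> aa bb H t /andP[h1 h2].
have [|d d0 hd] := H t; first by apply/andP; split; lra.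
by exists d => // t' /andP[h3 h4]; apply: hd; apply/andP; split; lra.
Qed.

Lemma flat_on_unique T eps h h' (a b : R) : line_connection T eps ->
  flat_on T h a b -> flat_on T h' a b ->
  forall s t, a <= s <= b -> a <= t <= b -> h s = h' s -> h t = h' t.
Proof.
move=> C Fh Fh'.
have loc t : a <= t <= b -> exists2 e : R, 0 < e &
     forall t', a <= t' <= b -> `|t' - t| < e -> (h t' = h' t' <-> h t = h' t).
  move=> abt; have [d d0 hd] := Fh t abt; have [d' d'0 hd'] := Fh' t abt.
  exists (Num.min (eps t) (Num.min d d')) => [|t' abt'].
    by rewrite !lt_min (lc_pos C) d0.
  rewrite !lt_min => /and3P[h1 h2 h3].
  rewrite (hd _ abt' h2) (hd' _ abt' h3); split=> [|-> //].
  by move/(congr1 (T t' t)); rewrite !(lc_inv C).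
have key s t : a <= s <= b -> a <= t <= b -> s <= t -> h s = h' s <-> h t = h' t.
  move=> abs abt st; split.
    apply: (locally_constant_segment (P := fun t => h t = h' t)) => // u su.
    have [|e e0 he] := loc u; first by apply/andP; split; lra.
    by exists e => // t' st'; apply: he; apply/andP; split; lra.
  (* The descent from [t] to [s] is an ascent on the reflected line. *)
  move=> ht; pose P u := h (- u) = h' (- u).
  have -> : s = - (- s) by rewrite opprK.
  apply: (@locally_constant_segment _ (- t) (- s) P); rewrite /P ?opprK ?lerN2 //.
  move=> u su; have [|e e0 he] := loc (- u); first by apply/andP; split; lra.
  exists e => // t' st' ht'; apply: he; first by apply/andP; split; lra.
  by rewrite -opprD normrN.
move=> s t abs abt; case: (lerP s t) => [st|/ltW ts].
  by move/(key s t abs abt st).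
by move/(key t s abt abs ts).
Qed.

(** Beyond [b] the section is transported from the centre [c], whose window contains the whole
    segment from [b] to [b']; the two definitions match at [b]. *)
Lemma flat_on_extend T eps h (a b b' c : R) : line_connection T eps ->
  a <= b -> b <= b' -> `|b - c| < eps c -> `|b' - c| < eps c ->
  flat_on T h a b ->
  exists h', (forall t, t <= b -> h' t = h t) /\ flat_on T h' a b'.
Proof.
move=> C ab bb' bc b'c Fh; pose x := T b c (h b).
pose h' t := if t <= b then h t else T c t x.
have near t : b <= t <= b' -> `|t - c| < eps c.
  move: bc b'c; rewrite !ltr_norml => /andP[h1 h2] /andP[h3 h4] /andP[h5 h6].
  by apply/andP; split; lra.
(* [c] may lie outside the window of [b], so this is the cocycle identity with target [b] rather
   than [lc_inv]. *)
have xb : T c b x = h b.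
  by rewrite /x (@lc_comp _ _ C b c b) ?subrr ?normr0 ?(lc_pos C) // (lc_id C).
exists h'; split=> [t tb|t /andP[at_ tb']]; first by rewrite /h' tb.
case: (ltrgtP t b) => [tb|bt|tb].
- have [|d d0 hd] := Fh t; first by rewrite at_ ltW.
  exists (Num.min d (b - t)) => [|t' /andP[at' t'b]]; first by rewrite lt_min d0 subr_gt0.
  rewrite lt_min => /andP[h1 h2].
  have t'b' : t' <= b by move: h2; rewrite ltr_norml => /andP[]; lra.
  by rewrite /h' t'b' (ltW tb); apply: hd => //; rewrite at' t'b'.
- exists (Num.min (eps t) (t - b)) => [|t' /andP[at' t'b]].
    by rewrite lt_min (lc_pos C) subr_gt0.
  rewrite lt_min => /andP[h1 h2].
  have bt' : b < t' by move: h2; rewrite ltr_norml => /andP[]; lra.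
  rewrite /h' !leNgt bt bt' /= (@lc_comp _ _ C c t t') //.
  by apply: near; rewrite t'b ltW.
- have [|d d0 hd] := Fh b; first by rewrite ab lexx.
  exists (Num.min d (eps b)) => [|t' /andP[at' t'b]].
    by rewrite lt_min d0 (lc_pos C).
  rewrite tb lt_min => /andP[h1 h2]; rewrite /h' lexx.
  case: lerP => [t'b'|bt']; first by apply: hd => //; rewrite at' t'b'.
  rewrite -xb (@lc_comp _ _ C c b t') //.
  by apply: near; rewrite t'b ltW.
Qed.

Lemma flat_right T eps (x : X) (a b : R) : line_connection T eps -> a <= b ->
  exists2 h, h a = x & flat_on T h a b.
Proof.
move=> C ab; pose P t := exists2 h, h a = x & flat_on T h a t.
apply: (locally_constant_segment (P := P)) ab _ _ => [c /andP[ac cb]|]; last first.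
  exists (fun=> x) => // t /andP[h1 h2].
  have -> : t = a by apply/le_anti; rewrite h1 h2.
  exists 1 => // t' /andP[h3 h4] _.
  have -> : t' = a by apply/le_anti; rewrite h3 h4.
  by rewrite (lc_id C).
exists (eps c) => [|b' /andP[ab' b'b] near]; first exact: lc_pos C c.
have ext u u' : a <= u -> `|u - c| < eps c -> `|u' - c| < eps c -> P u -> P u'.
  move=> au uc u'c [h ha Fh]; case: (lerP u' u) => [u'u|/ltW uu'].
    by exists h => //; apply: flat_on_sub Fh.
  have [h' [e Fh']] := flat_on_extend C au uu' uc u'c Fh.
  by exists h' => //; rewrite e.
by split; apply: ext => //; rewrite subrr normr0 (lc_pos C).
Qed.

Definition flat_line T h := forall t, exists2 d : R, 0 < d &
  forall t', `|t' - t| < d -> h t' = T t t' (h t).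

(** By uniqueness the sections chosen over the segments starting at [a] agree where they overlap, so
    their diagonal is flat. *)
Lemma flat_halfline T eps (x : X) (a : R) : line_connection T eps ->
  exists2 h, h a = x & forall b, flat_on T h a b.
Proof.
move=> C.
have /boolp.choice[H HP] : forall b, exists h, a <= b -> h a = x /\ flat_on T h a b.
  move=> b; case: (lerP a b) => [ab|ba]; last by exists (fun=> x).
  by have [h ha Fh] := flat_right x C ab; exists h.
exists (fun t => H t t) => [|b]; first by case: (HP a).
have HH t : a <= t <= b -> H t t = H b t.
  move=> /andP[at_ tb]; have [e1 F1] := HP t at_.
  have [e2 F2] := HP b (le_trans at_ tb).
  have F2' : flat_on T (H b) a t by apply: flat_on_sub F2.
  by apply: (flat_on_unique C F1 F2' _ _ (etrans e1 (esym e2))); rewrite ?lexx at_.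
move=> t abt; have ab : a <= b by lra.
have [_ /(_ t abt)[d d0 hd]] := HP b ab.
by exists d => // t' abt' h1; rewrite !HH //; apply: hd.
Qed.

Lemma exists_flat_line T eps (x : X) (a : R) : line_connection T eps ->
  exists2 h, h a = x & flat_line T h.
Proof.
move=> C; have [h1 e1 F1] := flat_halfline x a C.
pose T' s t := T (- s) (- t).
have C' : line_connection T' (fun t => eps (- t)).
  have E (s t : R) : `|- t - - s| = `|t - s| by rewrite -opprD normrN.
  split=> [t|t y|s t y|s t r y]; rewrite /T'.
  - exact: lc_pos C _.
  - exact: lc_id C _ _.
  - by rewrite -E; apply: lc_inv C _ _ _.
  - by rewrite -E -[X in _ -> X < _ -> _]E; apply: lc_comp C _ _ _ _.
have [h2 e2 F2] := flat_halfline x (- a) C'.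
pose h t := if a <= t then h1 t else h2 (- t).
exists h => [|t]; first by rewrite /h lexx.
have E (s u : R) : `|- u - - s| = `|u - s| by rewrite -opprD normrN.
case: (ltrgtP a t) => [at_|ta|<-].
- have [|d d0 hd] := F1 (t + 1) t; first by apply/andP; split; lra.
  exists (Num.min (Num.min d 1) (t - a)) => [|t']; first by rewrite !lt_min d0 ltr01 subr_gt0.
  rewrite !lt_min -andbA => /and3P[h3 h4 h5].
  move: (h4) (h5); rewrite !ltr_norml => /andP[h6 h7] /andP[h8 h9].
  have at' : a <= t' by lra.
  rewrite /h (ltW at_) at'; by apply: hd => //; apply/andP; split; lra.
- have [|d d0 hd] := F2 (- t + 1) (- t); first by apply/andP; split; lra.
  exists (Num.min (Num.min d 1) (a - t)) => [|t']; first by rewrite !lt_min d0 ltr01 subr_gt0.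
  rewrite !lt_min -andbA => /and3P[h3 h4 h5].
  move: (h4) (h5); rewrite !ltr_norml => /andP[h6 h7] /andP[h8 h9].
  have t'a : t' < a by lra.
  rewrite /h !leNgt ta t'a /=.
  by have := hd (- t'); rewrite E /T' !opprK => -> //; apply/andP; split; lra.
- have [|d d0 hd] := F1 (a + 1) a; first by apply/andP; split; lra.
  have [|d' d'0 hd'] := F2 (- a + 1) (- a); first by apply/andP; split; lra.
  exists (Num.min (Num.min d 1) d') => [|t']; first by rewrite !lt_min d0 ltr01.
  rewrite !lt_min -andbA => /and3P[h3 h4 h5].
  move: (h4); rewrite !ltr_norml => /andP[h6 h7].
  rewrite /h lexx; case: lerP => [at'|t'a].
    by apply: hd => //; apply/andP; split; lra.
  rewrite e1 -e2.
  by have := hd' (- t'); rewrite E /T' !opprK => -> //; apply/andP; split; lra.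
Qed.

End LineConnection.

(** * Flat sections over the plane and connectedness of the punctured plane *)

Section PlaneConnection.
Context {R : realType} {X : Type}.
Implicit Types (T : R * R -> R * R -> X -> X) (eps : R * R -> R).

Definition in_box (p : R * R) (e : R) (q : R * R) : bool :=
  (`|q.1 - p.1| < e) && (`|q.2 - p.2| < e).

Lemma in_box_refl p (e : R) : 0 < e -> in_box p e p.
Proof. by move=> e0; rewrite /in_box !subrr normr0 e0. Qed.

Record plane_connection T eps : Prop := {
  pc_pos : forall p, 0 < eps p;
  pc_id : forall p x, T p p x = x;
  pc_inv : forall p q x, in_box p (eps p) q -> T q p (T p q x) = x;
  pc_comp : forall p q r x, in_box p (eps p) r -> in_box q (eps q) r ->
    T q r (T p q x) = T p r x
}.

(* The section is built along the horizontal axis through [p0], then along every vertical line. *)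
Lemma exists_flat_plane T eps (x : X) (p0 : R * R) : plane_connection T eps ->
  exists2 H : R * R -> X, H p0 = x &
    forall p, exists2 d : R, 0 < d & forall q, in_box p d q -> H q = T p q (H p).
Proof.
move=> C; have pos := pc_pos C; case: p0 => a0 b0.
have Chor : line_connection (fun s t => T (s, b0) (t, b0)) (fun s => eps (s, b0)).
  split=> [t|t y|s t y st|s t r y sr tr]; first exact: pos.
  - exact: pc_id C _ _.
  - by apply: (pc_inv C); rewrite /in_box /= st subrr normr0 pos.
  - by apply: (pc_comp C); rewrite /in_box /= ?sr ?tr subrr normr0 pos.
have Cver a : line_connection (fun s t => T (a, s) (a, t)) (fun s => eps (a, s)).
  split=> [t|t y|s t y st|s t r y sr tr]; first exact: pos.
  - exact: pc_id C _ _.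
  - by apply: (pc_inv C); rewrite /in_box /= st subrr normr0 pos.
  - by apply: (pc_comp C); rewrite /in_box /= ?sr ?tr subrr normr0 pos.
have [h0 h0a Fh0] := exists_flat_line x a0 Chor.
have /boolp.choice[V HV] : forall a, exists h,
    h b0 = h0 a /\ flat_line (fun s t => T (a, s) (a, t)) h.
  by move=> a; have [h ? ?] := exists_flat_line (h0 a) b0 (Cver a); exists h.
pose H p := V p.1 p.2.
exists H => [|[a b]]; first by rewrite /H /= (HV _).1.
pose good b := exists2 d : R, 0 < d &
  forall q, in_box (a, b) d q -> H q = T (a, b) q (H (a, b)).
(* Uniqueness on the vertical lines spreads a transport formula for [H] from the height [b'] to the
   whole window of [(a, b1)], which gives flatness at every height [b''] in it. *)
have spread b1 b' b'' z d : 0 < d ->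
    `|b' - b1| < eps (a, b1) -> `|b'' - b1| < eps (a, b1) ->
    (forall a', `|a' - a| < d -> H (a', b') = T (a, b1) (a', b') z) -> good b''.
  move=> d0 near' near'' E; set e := eps (a, b1) in near' near''.
  have {}E a' y : `|a' - a| < Num.min d e -> `|y - b1| < e ->
      H (a', y) = T (a, b1) (a', y) z.
    rewrite lt_min => /andP[a'd a'e] ye.
    pose lo := Num.min y b'; pose hi := Num.max y b'.
    have lohi t : lo <= t <= hi -> `|t - b1| < e.
      move: ye near'; rewrite !ltr_norml => /andP[h1 h2] /andP[h3 h4].
      rewrite /lo /hi ge_min le_max => /andP[/orP[] h5 /orP[] h6];
        by apply/andP; split; lra.
    have F1 : flat_on (fun s t => T (a', s) (a', t)) (V a') lo hi.
      move=> t _; have [d' d'0 hd'] := (HV a').2 t.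
      by exists d' => // t' _; apply: hd'.
    have F2 : flat_on (fun s t => T (a', s) (a', t))
        (fun t => T (a, b1) (a', t) z) lo hi.
      move=> t ht; exists (eps (a', t)) => // t' ht' tt'.
      rewrite (@pc_comp _ _ C (a, b1) (a', t) (a', t')) //.
        by rewrite /in_box /= a'e lohi.
      by rewrite /in_box /= subrr normr0 pos tt'.
    apply: (flat_on_unique (Cver a') F1 F2 _ _ (E _ a'd)).
      by rewrite ge_min le_max !lexx !orbT.
    by rewrite ge_min le_max !lexx.
  pose m := Num.min (Num.min d e) (e - `|b'' - b1|).
  exists (Num.min m (eps (a, b''))) => [|[a' y]].
    by rewrite !lt_min d0 pos subr_gt0 near'' pos.
  rewrite /in_box /= !lt_min => /andP[/andP[/andP[h1 h2] h3] /andP[/andP[h4 h5] h6]].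
  have ye : `|y - b1| < e.
    have -> : y - b1 = (y - b'') + (b'' - b1) by ring.
    by apply: le_lt_trans (ler_normD _ _) _; lra.
  have E1 : H (a', y) = T (a, b1) (a', y) z by apply: E => //; rewrite lt_min.
  have E2 : H (a, b'') = T (a, b1) (a, b'') z.
    by apply: E => //; rewrite subrr normr0 lt_min d0 pos.
  rewrite E1 E2.
  rewrite (@pc_comp _ _ C) // /in_box /=; last by rewrite h3 h6.
  by rewrite ye andbT; case/andP: h1.
have prop b1 b' b'' : `|b' - b1| < eps (a, b1) -> `|b'' - b1| < eps (a, b1) ->
    good b' -> good b''.
  move=> n' n'' [d d0 hd]; set e := eps (a, b1) in n' n''.
  pose m := Num.min (Num.min d e) (eps (a, b')).
  apply: (spread b1 b' b'' (T (a, b') (a, b1) (H (a, b'))) m) => //.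
    by rewrite !lt_min d0 !pos.
  move=> a'; rewrite !lt_min => /andP[/andP[h1 h2] h3].
  rewrite hd; last by rewrite /in_box /= subrr normr0 h1 d0.
  have near : in_box (a, b1) e (a, b') by rewrite /in_box /= subrr normr0 pos.
  have far : in_box (a, b1) e (a', b') by rewrite /in_box /= h2.
  set w := H (a, b').
  have e1 : T (a, b1) (a, b') (T (a, b') (a, b1) w) = w.
    by rewrite (pc_comp C (p := (a, b'))) ?(pc_id C) // in_box_refl.
  have far' : in_box (a, b') (eps (a, b')) (a', b').
    by rewrite /in_box /= h3 subrr normr0 pos.
  by have := pc_comp C (T (a, b') (a, b1) w) far far'; rewrite e1.
have good0 : good b0.
  have [d d0 hd] := Fh0 a.
  apply: (spread b0 b0 b0 (h0 a) d) => //; rewrite ?subrr ?normr0 //.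
  by move=> a' /hd <-; rewrite /H /= (HV _).1.
have loc b1 : exists2 e : R, 0 < e & forall b', `|b' - b1| < e -> (good b' <-> good b1).
  exists (eps (a, b1)) => // b' n'.
  by split; apply: (prop b1) => //; rewrite subrr normr0.
case: (lerP b0 b) => [b0b|/ltW bb0].
  apply: (locally_constant_segment (P := good)) b0b _ good0 => t _.
  by have [e e0 he] := loc t; exists e => // t' _; apply: he.
rewrite -/(good b) -[b]opprK.
apply: (@locally_constant_segment _ (- b0) (- b) (fun t => good (- t))).
- by rewrite lerN2.
- move=> t _; have [e e0 he] := loc (- t); exists e => // t' _ h; apply: he.
  by rewrite -opprD normrN.
- by rewrite opprK.
Qed.

(* Horizontal and vertical moves avoiding [c] lead from any point to [(c.1 + 1, c.2 + 1)]. *)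
Lemma locally_constant_punctured (c : R * R) (h : R * R -> X) :
  (forall p, p <> c -> exists2 d : R, 0 < d &
     forall q, q <> c -> in_box p d q -> h q = h p) ->
  forall p q, p <> c -> q <> c -> h p = h q.
Proof.
case: c => c1 c2 loc.
have seg (f : R -> R * R) :
   (forall s t (e : R), `|t - s| < e -> in_box (f s) e (f t)) ->
   (forall t, f t <> (c1, c2)) -> forall s t, s <= t -> h (f s) = h (f t).
  move=> box av s t st.
  apply: (locally_constant_segment (P := fun t => h (f s) = h (f t))) st _ _ => // u _.
  have [d d0 hd] := loc (f u) (av u); exists d => // t' _ t'u.
  by rewrite (hd (f t')) //; apply: box.
have hor b s t : b <> c2 -> h (s, b) = h (t, b).
  move=> bc; case: (lerP s t) => [st|/ltW ts]; [|symmetry];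
    by apply: (seg (fun t => (t, b))) => // [u v e uv|u [_ /bc//]];
      rewrite /in_box /= uv subrr normr0 (le_lt_trans _ uv).
have ver a s t : a <> c1 -> h (a, s) = h (a, t).
  move=> ac; case: (lerP s t) => [st|/ltW ts]; [|symmetry];
    by apply: (seg (fun t => (a, t))) => // [u v e uv|u [/ac//]];
      rewrite /in_box /= uv subrr normr0 (le_lt_trans _ uv).
have ne (z : R) : z + 1 <> z.
  by apply/eqP; rewrite -subr_eq0 addrAC subrr add0r oner_eq0.
suff main p : p <> (c1, c2) -> h p = h (c1 + 1, c2 + 1).
  by move=> p q /main -> /main ->.
case: p => x y xy; have [yc|/eqP yc] := eqVneq y c2; last first.
  by rewrite (hor _ x (c1 + 1)) // (ver _ y (c2 + 1)).
have xc : x <> c1 by move=> xc; apply: xy; rewrite xc yc.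
by rewrite (ver _ y (c2 + 1)) // (hor _ x (c1 + 1)).
Qed.

End PlaneConnection.

(** * The topology of a triangulated plane *)

Section PlaneComplex.
Local Open Scope classical_set_scope.
Local Open Scope fset_scope.
Local Open Scope ring_scope.
Context {R : realType} {V : choiceType}.
Variable K : set {fset V}.
Hypothesis HK : triangulates_plane R K.

(* [c p] is the simplex carrying the point of the realization at position [p] of the plane, and
   [P u] is the position of the vertex [u]. *)
Lemma exists_carrier : exists (c : R * R -> {fset V}) (P : V -> R * R),
  [/\ forall p, K (c p),
      forall p, exists2 d : R, 0 < d & forall q, in_box p d q -> c p `<=` c q,
      forall p u, c p = [fset u] <-> p = P u &
      forall u w, K [fset u; w] -> exists gam : R -> R * R,
        [/\ gam 0 = P u, gam 1 = P w,
            forall t, c (gam t) `<=` [fset u; w] &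
            forall t (d : R), 0 < d -> exists2 e : R, 0 < e &
              forall t', 0 <= t' <= 1 -> `|t' - t| < e -> in_box (gam t) d (gam t')]].
Proof.
have [SC [f [g [cf cg Ag fg gf]]]] := HK.
have /boolp.choice[c Hc] : forall p, exists s, K s /\ forall v, (v \in s) = (0 < g p v).
  move=> p; have [pos [s [Ks supp sum1]]] := Ag p.
  exists [fset v in s | 0 < g p v]; split; last first.
    move=> v; rewrite !inE /=; case: (boolP (v \in s)) => //= vs.
    by rewrite (supp v vs) ltxx.
  apply: (sc_face SC Ks); first by apply/fsubsetP => v; rewrite !inE => /andP[].
  apply/negP => /eqP E0; have := oner_neq0 R; rewrite -sum1 big_seq big1 ?eqxx // => v vs.
  apply/eqP/negPn/negP => n0; suff : v \in fset0 by rewrite inE.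
  by rewrite -E0 !inE /= vs lt_neqAle eq_sym n0 pos.
have boxE p (d : R) q : in_box p d q = (ball p d q : Prop) :> Prop.
  apply/propext; rewrite /in_box /ball /= /prod_ball /ball /= /ball_ /=.
  by rewrite (distrC p.1) (distrC p.2); split=> [/andP[]|[-> ->]].
pose pt (a b : V) (t : R) : {ptws V -> R} :=
  fun v => (1 - t) *+ (v == a) + t *+ (v == b).
have ptA a b (t : R) : K [fset a; b] -> 0 <= t <= 1 -> realization K (pt a b t).
  move=> Kab /andP[t0 t1]; split=> [v|].
    by rewrite addr_ge0 // mulrn_wge0 // subr_ge0.
  exists [fset a; b]; split=> // [v|].
    by rewrite /pt !inE negb_or => /andP[/negbTE-> /negbTE->]; rewrite !mulr0n addr0.
  rewrite /pt big_split /=.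
  have sum1 (x : V) (y : R) : x \in [fset a; b] ->
      \sum_(v <- [fset a; b]) y *+ (v == x) = y.
    move=> xab; rewrite (big_fsetD1 x) //= eqxx big_seq big1 ?addr0 // => v.
    by rewrite !inE => /andP[/negbTE->].
  by rewrite !sum1 ?inE ?eqxx ?orbT // subrK.
have cE (x : {ptws V -> R}) u : realization K x -> (u \in c (f x)) = (0 < x u).
  by move=> Ax; rewrite (Hc _).2 gf.
exists c, (fun u => f (pt u u 0)); split=> [p|p|p u|u w Kuw]; first by case: (Hc p).
(* Positivity of finitely many barycentric coordinates is an open condition, so the carrier can only
   grow near [p]. *)
- have near : nbhs p (\bigcap_(v in [set` c p]) [set q | 0 < g q v]).
    apply: filter_bigI => v; rewrite (Hc p).2 => gp.
    have cv : (fun q => g q v) @ p --> g p v.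
      by apply: (@continuous_comp _ _ _ g (proj v)); [exact: cg|exact: proj_continuous].
    exact: (cv _ (lt_nbhsr gp)).
  have /nbhs_ballP[d /= d0 hd] := near; exists d => // q; rewrite boxE => /hd H.
  by apply/fsubsetP => v vc; rewrite (Hc q).2; exact: (H v vc).
- have ptE : pt u u 0 = fun v => 1 *+ (v == u).
    by apply/funext => v; rewrite /pt subr0 mul0rn addr0.
  have Apt : realization K (pt u u 0).
    apply: ptA; rewrite ?lexx ?ler01 // fsetUid; exact: sc_vertex SC u.
  split=> [cpu|->]; last first.
    apply/fsetP => v; rewrite cE // ptE !inE.
    by case: (v == u); rewrite ?mulr1n ?mulr0n ?ltr01 ?ltxx.
  have [pos [s [_ supp sum1]]] := Ag p.
  have g0 v : v != u -> g p v = 0.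
    move=> vu; apply/eqP; rewrite eq_le pos andbT leNgt -(Hc p).2 cpu inE.
    exact: vu.
  rewrite -[p in LHS]fg; congr f; rewrite ptE; apply/funext => v.
  case: eqVneq => [->|/g0 //]; rewrite mulr1n -sum1.
  have us : u \in s.
    apply/negPn/negP => us; have := oner_neq0 R; rewrite -sum1 big_seq big1 ?eqxx //.
    by move=> w ws; apply: g0; apply: contraNneq us => <-.
  rewrite (big_fsetD1 u) //= big_seq big1 ?addr0 // => w.
  by rewrite !inE => /andP[/g0].
(* Clamping the parameter keeps the path in the realization for every real [t]. *)
pose cl (t : R) := Num.max 0 (Num.min 1 t).
have cl01 t : 0 <= cl t <= 1.
  by rewrite /cl le_max lexx /= ge_max ler01 ge_min lexx.
have clid t : 0 <= t <= 1 -> cl t = t.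
  by move=> /andP[t0 t1]; rewrite /cl (min_idPr t1) (max_idPr t0).
exists (fun t => f (pt u w (cl t))); split.
- rewrite clid ?lexx ?ler01 //; congr f; apply/funext => v.
  by rewrite /pt !mul0rn.
- rewrite clid ?lexx ?ler01 //; congr f; apply/funext => v.
  by rewrite /pt subrr subr0 mul0rn add0r mul0rn addr0.
- move=> t; apply/fsubsetP => v; rewrite cE ?inE; last exact: ptA.
  by rewrite /pt; case: (v == u); case: (v == w) => //; rewrite !mulr0n addr0 ltxx.
move=> t d d0.
have cpt : continuous (fun t => pt u w t).
  have cv v : continuous (fun t => pt u w t v).
    move=> s; apply: cvgD; apply: cvgMn; last exact: cvg_id.
    by apply: cvgB; [exact: cvg_cst|exact: cvg_id].
  move=> s; apply/cvg_sup => v; move: s.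
  apply/(@continuousP _ (initial_topology (@^~ v))) => A [B oB <-].
  exact: (open_comp _ oB).
have ccl : continuous cl.
  move=> s; apply: continuous_max; first exact: cvg_cst.
  by apply: continuous_min; [exact: cvg_cst|exact: cvg_id].
have cgam : continuous (pt u w \o cl).
  by move=> s; apply: continuous_comp; [exact: ccl|exact: cpt].
have /subspace_continuousP/(_ _ (ptA _ _ _ Kuw (cl01 t))) cft := cf.
have nb : nbhs (f (pt u w (cl t))) (ball (f (pt u w (cl t))) d) by exact: nbhsx_ballx.
have /cgam/= := cft _ nb.
rewrite nbhs_simpl /= => /nbhs_ballP[e /= e0 he].
exists e => // t' t'01 tt'; rewrite boxE.
have := he t'; rewrite /ball /= /ball_ /= distrC => /(_ tt'); apply.
exact: ptA.
Qed.

(* This is where the simple connectivity of the plane enters: [tau] is a flat bundle with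
   discrete fibre [X] over the vertices. *)
Lemma exists_flat_section (X : Type) (tau : V -> V -> X -> X) (o : V) (x0 : X) :
  (forall u x, tau u u x = x) ->
  (forall s u v w x, K s -> u \in s -> v \in s -> w \in s ->
     tau v w (tau u v x) = tau u w x) ->
  exists2 sec : V -> X, sec o = x0 &
    forall u w, K [fset u; w] -> sec w = tau u w (sec u).
Proof.
move=> tau_id tau_comp.
have [c [P [Kc grow vert edges]]] := exists_carrier.
have /boolp.choice[pt ptc] : forall p, exists v, v \in c p.
  by move=> p; have /fset0Pn[v vc] := sc_nonempty (HK.1) (Kc p); exists v.
have /boolp.choice[eps Heps] : forall p, exists d : R,
    0 < d /\ forall q, in_box p d q -> {subset c p <= c q}.
  by move=> p; have [d d0 hd] := grow p; exists d; split=> // q /hd/fsubsetP.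
(* The fibre at a position is the fibre at a vertex chosen in its carrier. *)
pose T p q := tau (pt p) (pt q).
have C : plane_connection T eps.
  split=> [p|p x|p q x pq|p q r x pr qr]; rewrite /T.
  - by case: (Heps p).
  - exact: tau_id.
  - have ppq := (Heps p).2 _ pq _ (ptc p).
    by rewrite (tau_comp (c q)) ?tau_id.
  - have ppr := (Heps p).2 _ pr _ (ptc p); have pqr := (Heps q).2 _ qr _ (ptc q).
    by rewrite (tau_comp (c r)).
have ptP u : pt (P u) = u.
  by apply/fset1P; rewrite -(iffRL (vert (P u) u)).
have [H H0 FH] := exists_flat_plane x0 (P o) C.
exists (fun u => H (P u)) => // u w Kuw.
have [gam [g0 g1 gsub gcont]] := edges u w Kuw.
have ptg t : pt (gam t) \in [fset u; w] by apply: (fsubsetP (gsub t)).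
have uu : u \in [fset u; w] by rewrite !inE eqxx.
have ww : w \in [fset u; w] by rewrite !inE eqxx orbT.
(* The value at [gam t], brought back to [u]. It is locally constant because all vertices involved
   lie in the edge, where [tau] is a cocycle. *)
pose h t := tau (pt (gam t)) u (H (gam t)).
suff e01 : h 0 = h 1.
  have h0 : h 0 = H (P u) by rewrite /h g0 ptP tau_id.
  have h1 : h 1 = tau w u (H (P w)) by rewrite /h g1 ptP.
  by rewrite -h0 e01 h1 (tau_comp [fset u; w]) // tau_id.
apply: (locally_constant_segment (P := fun t => h 0 = h t)) (@ler01 R) _ _ => // t _.
have [d d0 hd] := FH (gam t); have [e e0 he] := gcont t d d0.
exists e => // t' t'01 tt'; rewrite /h (hd (gam t')); last exact: he.
by rewrite /T (tau_comp [fset u; w]).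
Qed.

(** Every position other than that of [v] has a vertex different from [v] in its carrier. The value
    of [F] there is locally constant, as nearby choices share a simplex, and the punctured plane is
    connected. *)
Lemma no_cut_vertex (T : Type) (F : V -> T) (v : V) :
  (forall u w, K [fset u; w] -> u <> v -> w <> v -> F u = F w) ->
  forall u w, u <> v -> w <> v -> F u = F w.
Proof.
move=> Fe; have [c [P [Kc grow vert _]]] := exists_carrier.
have /boolp.choice[pt ptc] : forall p, exists u, p <> P v -> u \in c p /\ u <> v.
  move=> p; case: (boolP (c p `<=` [fset v])) => [cv|/fsubsetPn[u uc]].
    exists v => pv; exfalso; apply: pv; apply/vert/eqP; rewrite eqEfsubset cv.
    have /fset0Pn[u uc] := sc_nonempty (HK.1) (Kc p).
    by rewrite fsub1set; have /fset1P <- := fsubsetP cv u uc.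
  by rewrite inE => uv; exists u => _; split=> //; apply/eqP.
have sub2 s a b : K s -> a \in s -> b \in s -> K [fset a; b].
  move=> Ks sa sb; apply: (sc_face HK.1 Ks).
    by apply/fsubsetP => x; rewrite !inE => /orP[]/eqP->.
  by apply/fset0Pn; exists a; rewrite !inE eqxx.
have FpE p q : p <> P v -> q <> P v -> F (pt p) = F (pt q).
  apply: (locally_constant_punctured (h := fun p => F (pt p))) => {}p pv.
  have [d d0 hd] := grow p; exists d => // {}q qv /hd/fsubsetP cpq.
  have [pp pnv] := ptc p pv; have [qq qnv] := ptc q qv.
  by apply: Fe => //; apply: (sub2 (c q)) => //; apply: cpq.
have ptP u : u <> v -> pt (P u) = u /\ P u <> P v.
  move=> uv; have cu := iffRL (vert (P u) u) erefl.
  have ne : P u <> P v.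
    by move=> /vert; rewrite cu => /fsetP/(_ u); rewrite !inE eqxx => /esym/eqP.
  split=> //; have [+ _] := ptc _ ne; by rewrite cu => /fset1P.
move=> u w /ptP[eu nu] /ptP[ew nw].
by rewrite -eu -ew; apply: FpE.
Qed.

End PlaneComplex.

(** * The combinatorial model *)

Section Model.
Local Open Scope nat_scope.

(* The model of the tessellation: a vertex is a word whose head is its last digit, the empty
   word is the root, and the word [d :: w] is the [d]-th vertex of the block of children owned
   by [w]. Among the children of [w], the first one of the block has two parents, [w] and its
   predecessor on the same circle, unless [w] is the root. *)
Definition two_parents (v : seq nat) : bool :=
  if v is d :: w then (d == 0) && (w != [::]) else false.

(** Off the root, the 8 neighbours less one or two parents, two neighbours on the circle and the
    last child, which belongs to the block of the next word. *)
Definition block_size (v : seq nat) : nat :=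
  if v is [::] then 8 else if two_parents v then 3 else 4.

Fixpoint word (v : seq nat) : bool :=
  if v is d :: w then (d < block_size w) && word w else true.

(** Successor on the circle: a full block carries over to the next parent, and the circle closes up
    because the root is its own successor. *)
Fixpoint next_word (v : seq nat) : seq nat :=
  if v is d :: w then
    if d.+1 < block_size w then d.+1 :: w else 0 :: next_word w
  else [::].

Fixpoint prev_word (v : seq nat) : seq nat :=
  if v is d :: w then
    if d is d'.+1 then d' :: w else (block_size (prev_word w)).-1 :: prev_word w
  else [::].

Lemma block_size_gt0 v : 0 < block_size v.
Proof. by case: v => //= d w; case: ifP. Qed.

Lemma size_next v : size (next_word v) = size v.
Proof. by elim: v => //= d w IH; case: ifP => //= _; rewrite IH. Qed.

Lemma size_prev v : size (prev_word v) = size v.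
Proof. by elim: v => //= -[|d] w IH //=; rewrite IH. Qed.

Lemma next_nil v : (next_word v == [::]) = (v == [::]).
Proof. by rewrite -!size_eq0 size_next. Qed.

Lemma prev_nil v : (prev_word v == [::]) = (v == [::]).
Proof. by rewrite -!size_eq0 size_prev. Qed.

Lemma word_next v : word v -> word (next_word v).
Proof.
elim: v => //= d w IH /andP[dw ww]; case: ifP => /= [-> //|_].
by rewrite block_size_gt0 IH.
Qed.

Lemma word_prev v : word v -> word (prev_word v).
Proof.
elim: v => //= -[|d] w IH /= /andP[dw ww]; last by rewrite (ltnW dw).
by rewrite IH // andbT ltn_predL block_size_gt0.
Qed.

Lemma prev_next v : word v -> prev_word (next_word v) = v.
Proof.
elim: v => //= d w IH /andP[dw ww]; case: ifP => //= H; rewrite IH //.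
by congr (_ :: _); lia.
Qed.

Lemma next_prev v : word v -> next_word (prev_word v) = v.
Proof.
elim: v => //= -[|d] w IH /= /andP[dw ww]; last by rewrite dw.
by rewrite prednK ?block_size_gt0 // ltnn IH.
Qed.

Definition child_pos (w : seq nat) (d : nat) : nat :=
  if w is [::] then d else d + (if two_parents w then 3 else 2).

Definition prev_pos (v : seq nat) : nat := if two_parents v then 2 else 1.

Definition dart := (seq nat * nat)%type.

Definition good_dart (x : dart) : bool := word x.1 && (x.2 < 8).

Definition turn (x : dart) : dart := (x.1, (x.2 + 1) %% 8).

Definition turn_back (x : dart) : dart := (x.1, (x.2 + 7) %% 8).

(* The dart [(v, j)] leads to the [j]-th neighbour of [v]. At a nonempty word these are, in cyclic
   order from 0: the parent, the other parent if there is one, the previous word, the own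
   children, at 6 the first child of the next word, and at 7 the next word. *)
Definition reverse (x : dart) : dart :=
  let: (v, j) := x in
  if v is d :: w then
    if j == 0 then (w, child_pos w d)
    else if j == 7 then (next_word v, prev_pos (next_word v))
    else if j == 6 then (0 :: next_word v, 1)
    else if j == prev_pos v then (prev_word v, 7)
    else if j == 1 then (prev_word w, 6)
    else (j - (if two_parents v then 3 else 2) :: v, 0)
  else ([:: j], 0).

Lemma good_turn x : good_dart x -> good_dart (turn x).
Proof. by case: x => v j /andP[/= wv _]; rewrite /good_dart /= wv ltn_mod. Qed.

Lemma good_turn_back x : good_dart x -> good_dart (turn_back x).
Proof. by case: x => v j /andP[/= wv _]; rewrite /good_dart /= wv ltn_mod. Qed.

Lemma turnK x : good_dart x -> turn_back (turn x) = x.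
Proof. by case: x => v j /andP[/= _ j8]; rewrite /turn /turn_back /=; congr pair; lia. Qed.

Lemma turn_backK x : good_dart x -> turn (turn_back x) = x.
Proof. by case: x => v j /andP[/= _ j8]; rewrite /turn /turn_back /=; congr pair; lia. Qed.

Lemma iter8_turn x : good_dart x -> iter 8 turn x = x.
Proof.
by case: x => v j /andP[/= _ j8]; rewrite /turn /=; congr pair; lia.
Qed.

Lemma two_parents_cons0 w : two_parents (0 :: w) = (w != [::]).
Proof. by []. Qed.

Lemma reverse_child d w : word (d :: w) ->
  reverse (w, child_pos w d) = (d :: w, 0).
Proof.
case: w => [//|e u] /andP[/= + _]; rewrite /prev_pos /= /block_size /=.
case: ifP => _ dlt;
  repeat (case: ifP => [/eqP|_]; first by lia); by congr (_ :: _, _); lia.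
Qed.

Lemma reverse_next v : v <> [::] ->
  reverse (v, 7) = (next_word v, prev_pos (next_word v)).
Proof. by case: v. Qed.

Lemma reverse_prev v : v <> [::] -> reverse (v, prev_pos v) = (prev_word v, 7).
Proof. by case: v => // d w _; rewrite /reverse /prev_pos; case: two_parents. Qed.

Lemma reverse_last v : v <> [::] -> reverse (v, 6) = (0 :: next_word v, 1).
Proof. by case: v. Qed.

Lemma reverse_parent2 w : w <> [::] -> reverse (0 :: w, 1) = (prev_word w, 6).
Proof. by case: w. Qed.

(** The cases are paired by [reverse]: child with parent, next with previous, last child with second
    parent. *)
Inductive dart_spec : seq nat -> nat -> Prop :=
| DartChild v e of e < block_size v : dart_spec v (child_pos v e)
| DartParent d w : dart_spec (d :: w) 0
| DartNext v of v <> [::] : dart_spec v 7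
| DartPrev v of v <> [::] : dart_spec v (prev_pos v)
| DartLast v of v <> [::] : dart_spec v 6
| DartParent2 w of w <> [::] : dart_spec (0 :: w) 1.

Lemma dartP v j : good_dart (v, j) -> dart_spec v j.
Proof.
case: v => [|d w] /andP[/= wv j8]; first exact: (@DartChild [::]).
have [->|j0] := eqVneq j 0; first exact: DartParent.
have [->|j7] := eqVneq j 7; first exact: DartNext.
have [->|j6] := eqVneq j 6; first exact: DartLast.
have [->|jp] := eqVneq j (prev_pos (d :: w)); first exact: DartPrev.
case tp: (two_parents (d :: w)).
  have [->|j1] := eqVneq j 1.
    by case/andP: tp => /eqP-> w0; apply: DartParent2; apply/eqP.
  have -> : j = child_pos (d :: w) (j - 3).
    by move: jp; rewrite /child_pos /prev_pos tp; lia.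
  by apply: DartChild; move: jp; rewrite /block_size /prev_pos tp; lia.
have -> : j = child_pos (d :: w) (j - 2).
  by move: jp; rewrite /child_pos /prev_pos tp; lia.
by apply: DartChild; move: jp; rewrite /block_size /prev_pos tp; lia.
Qed.

Lemma child_pos_lt w d : d < block_size w -> child_pos w d < 8.
Proof.
by case: w => // e u; rewrite /block_size /child_pos; case: ifP => _; lia.
Qed.

Lemma prev_pos_lt v : prev_pos v < 7.
Proof. by rewrite /prev_pos; case: ifP. Qed.

Lemma good_reverse x : good_dart x -> good_dart (reverse x).
Proof.
case: x => v j gx; have wv : word v by case/andP: gx.
case: (dartP gx) wv => {j gx} [u e ue wu|d w /= /andP[dw ww]|u u0 wu|u u0 wu|u u0 wu|w w0].
- have wu' : word (e :: u) by rewrite /= ue.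
  by rewrite reverse_child // /good_dart wu'.
- by rewrite /good_dart /= ww child_pos_lt.
- by rewrite reverse_next // /good_dart /= word_next // (ltn_trans (prev_pos_lt _)).
- by rewrite reverse_prev // /good_dart /= word_prev.
- by rewrite reverse_last // /good_dart /= word_next // block_size_gt0.
- by move=> w0w; have /andP[_ ww] := w0w; rewrite reverse_parent2 // /good_dart /= word_prev.
Qed.

Lemma reverseK x : good_dart x -> reverse (reverse x) = x.
Proof.
case: x => v j gx; have wv : word v by case/andP: gx.
have ne w : w <> [::] -> next_word w <> [::].
  by move=> /eqP w0; apply/eqP; rewrite next_nil.
have pe w : w <> [::] -> prev_word w <> [::].
  by move=> /eqP w0; apply/eqP; rewrite prev_nil.
case: (dartP gx) wv => {j gx} [u e ue wu|d w wv|u u0 wu|u u0 wu|u u0 wu|w w0].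
- have wu' : word (e :: u) by rewrite /= ue.
  by rewrite reverse_child.
- by rewrite -[reverse (d :: w, 0)]/(w, child_pos w d) reverse_child.
- by rewrite reverse_next // reverse_prev ?prev_next //; apply: ne.
- by rewrite reverse_prev // reverse_next ?next_prev //; apply: pe.
- by rewrite reverse_last // reverse_parent2 ?prev_next //; apply: ne.
- move=> w0w; have /andP[_ ww] := w0w; rewrite reverse_parent2 // reverse_last ?next_prev //.
  exact: pe.
Qed.

Lemma turnE v j : turn (v, j) = (v, (j + 1) %% 8).
Proof. by []. Qed.

(** One step around the triangle between the positions [j] and [j + 1], always keeping it on the
    same side. *)
Definition face_step (x : dart) : dart := reverse (turn x).

(* A triangle is spanned either by a word, one of its own children and the next word after
   that child, or by two consecutive words of a circle and their common child. *)
Lemma face_down d w (c := d :: w) (p := if d.+1 < block_size w then 0 else (w != [::] : nat)) :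
  word c ->
  [/\ face_step (w, child_pos w d) = (next_word c, p),
      face_step (next_word c, p) = (c, 7) &
      face_step (c, 7) = (w, child_pos w d)].
Proof.
(* [p] is the position of [w] as seen from the next word: 0 inside the block, otherwise 1, since [w]
   is then the second parent; at the root the circle closes up and it is 0 again. *)
move=> wc; have [dw ww] := andP wc; rewrite /face_step !turnE.
have nc : next_word c = if d.+1 < block_size w then d.+1 :: w else 0 :: next_word w by [].
split; last by [].
- rewrite nc /p; case: ifP => [d1|d1].
    have -> : (child_pos w d + 1) %% 8 = child_pos w d.+1.
      have := child_pos_lt d1.
      by rewrite /child_pos; case: (w) => [|e u]; lia.
    by rewrite reverse_child // /word d1 ww.
  case: (w) dw d1 => [|e u] dw d1.
    by have -> : d = 7 by move: dw d1 => /=; lia.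
  have -> : (child_pos (e :: u) d + 1) %% 8 = 6.
    by move: dw d1; rewrite /child_pos /block_size; case: ifP => _; lia.
  by rewrite reverse_last.
have -> : (p + 1) %% 8 = prev_pos (next_word c).
  rewrite /p /prev_pos nc; case: ifP => [//|d1].
  by rewrite two_parents_cons0 next_nil; case: (w == [::]).
by rewrite reverse_prev ?prev_next // /c /=; case: ifP.
Qed.

Lemma face_up v : word v -> v <> [::] ->
  [/\ face_step (v, 6) = (next_word v, prev_pos (next_word v)),
      face_step (next_word v, prev_pos (next_word v)) = (0 :: next_word v, 0) &
      face_step (0 :: next_word v, 0) = (v, 6)].
Proof.
move=> wv v0; have nv0 : next_word v <> [::] by apply/eqP; rewrite next_nil; apply/eqP.
rewrite /face_step !turnE; split.
- by rewrite reverse_next.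
- have -> : (prev_pos (next_word v) + 1) %% 8 = child_pos (next_word v) 0.
    by rewrite /prev_pos /child_pos; case: (next_word v) nv0 => // e u _; case: ifP.
  by rewrite reverse_child // -/word [word _]/= block_size_gt0 word_next.
- by rewrite reverse_parent2 // prev_next.
Qed.

Lemma face_step3 x : good_dart x -> face_step (face_step (face_step x)) = x.
Proof.
case: x => v j gx; have wv : word v by case/andP: gx.
have pe w : w <> [::] -> prev_word w <> [::].
  by move=> /eqP w0; apply/eqP; rewrite prev_nil.
case: (dartP gx) wv => {j gx} [u e ue wu|d w wv|u u0 wu|u u0 wu|u u0 wu|w w0].
- have [|e1 e2 e3] := @face_down e u; first by rewrite /= ue.
  by rewrite e1 e2.
- have [ww dw] := andP wv.
  case tp: (two_parents (d :: w)).
    case/andP: tp => /eqP d0 /eqP w0; rewrite d0.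
    have [] := face_up (word_prev dw) (pe _ w0).
    by rewrite next_prev // => e1 e2 e3; rewrite e3 e1.
  case: d => [|d] in wv ww tp *.
    have w0 : w = [::] by move: tp; rewrite two_parents_cons0; case: (w).
    by rewrite w0.
  have wd : word (d :: w) by move: wv => /= /andP[/ltnW -> ->].
  have := face_down wd; rewrite /= ww => -[e1 e2 e3].
  by rewrite e2 e3.
- case: u u0 wu => // d w _ wu; have [e1 e2 e3] := face_down wu.
  by rewrite e3 e1.
- have [] := face_up (word_prev wu) (pe _ u0).
  by rewrite next_prev // => e1 e2 e3; rewrite e2 e3.
- by have [e1 e2 e3] := face_up wu u0; rewrite e1 e2.
- move=> /andP[_ ww].
  have wd : word (prev_word (0 :: w)) by apply: word_prev; rewrite /= block_size_gt0.
  have := face_down wd; rewrite /= prednK ?block_size_gt0 // ltnn next_prev //.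
  by rewrite prev_nil (introN eqP w0) => -[e1 e2 e3]; rewrite e2 e3.
Qed.

(** The map iterated here is conjugate under [reverse] to the inverse of [face_step]. *)
Lemma face_step_back3 x : good_dart x ->
  reverse (turn_back (reverse (turn_back (reverse (turn_back x))))) = x.
Proof.
move=> gx; have gb := good_turn_back; have gr := good_reverse.
have gu1 := gb _ gx; have gx1 := gr _ gu1; have gu2 := gb _ gx1.
have gx2 := gr _ gu2; have gu3 := gb _ gx2.
have := face_step3 gu3; rewrite /face_step !turn_backK // !reverseK // !turn_backK // reverseK //.
rewrite !turn_backK // => <-; exact: reverseK.
Qed.

(* The boolean component is the colour of the triangle to the left of the dart. *)
Definition coloured_dart := (dart * bool)%type.

(** Reflection across the triangle of colour [k] at the dart, which lies to its left or to its right
    according to the colour bit. Other darts are fixed so that the relations hold on the whole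
    type. *)
Definition model_turn (k : bool) (x : coloured_dart) : coloured_dart :=
  if good_dart x.1 then (if x.2 == k then turn x.1 else turn_back x.1, ~~ x.2) else x.

Definition model_flip (x : coloured_dart) : coloured_dart :=
  if good_dart x.1 then (reverse x.1, ~~ x.2) else x.

Lemma model_turn_same k d : good_dart d -> model_turn k (d, k) = (turn d, ~~ k).
Proof. by move=> gd; rewrite /model_turn /= gd eqxx. Qed.

Lemma model_turn_other k d : good_dart d -> model_turn k (d, ~~ k) = (turn_back d, k).
Proof. by move=> gd; rewrite /model_turn /= gd negbK; case: (k). Qed.

Lemma model_flip_good d c : good_dart d -> model_flip (d, c) = (reverse d, ~~ c).
Proof. by move=> gd; rewrite /model_flip /= gd. Qed.

Lemma model_turn_bad k d c : good_dart d = false -> model_turn k (d, c) = (d, c).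
Proof. by move=> gd; rewrite /model_turn /= gd. Qed.

Lemma model_flip_bad d c : good_dart d = false -> model_flip (d, c) = (d, c).
Proof. by move=> gd; rewrite /model_flip /= gd. Qed.

Lemma colour_cases (k c : bool) : c = k \/ c = ~~ k.
Proof. by case: k c => -[]; [left|right|right|left]. Qed.

Lemma model_turnK k : involutive (model_turn k).
Proof.
case=> d c; case gd: (good_dart d); last by rewrite !model_turn_bad.
have [->|->] := colour_cases k c.
  by rewrite model_turn_same // model_turn_other ?good_turn // turnK.
by rewrite model_turn_other // model_turn_same ?good_turn_back // turn_backK.
Qed.

Lemma model_flipK : involutive model_flip.
Proof.
case=> d c; case gd: (good_dart d); last by rewrite !model_flip_bad.
by rewrite !model_flip_good ?good_reverse // negbK reverseK.
Qed.

Lemma model_face k x :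
  model_flip (model_turn k (model_flip (model_turn k (model_flip (model_turn k x))))) = x.
Proof.
case: x => d c; case gd: (good_dart d); last by rewrite !(model_turn_bad, model_flip_bad).
have gt := good_turn; have gb := good_turn_back; have gr := good_reverse.
have [->|->] := colour_cases k c.
  rewrite model_turn_same // model_flip_good ?negbK; last exact: gt.
  rewrite model_turn_same ?model_flip_good ?negbK; [|exact/gt/gr/gt|exact/gr/gt].
  rewrite model_turn_same ?model_flip_good ?negbK; [|exact/gt/gr/gt/gr/gt|exact/gr/gt/gr/gt].
  congr pair; exact: face_step3.
rewrite model_turn_other // model_flip_good; last exact: gb.
rewrite model_turn_other ?model_flip_good; [|exact/gb/gr/gb|exact/gr/gb].
rewrite model_turn_other ?model_flip_good; [|exact/gb/gr/gb/gr/gb|exact/gr/gb/gr/gb].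
congr pair; exact: face_step_back3.
Qed.

Lemma iter8_turn_back x : good_dart x -> iter 8 turn_back x = x.
Proof.
by case: x => v j /andP[/= _ j8]; rewrite /turn_back /=; congr pair; lia.
Qed.

Lemma model_round x :
  iter 4 (fun y => model_turn true (model_turn false y)) x = x.
Proof.
case: x => d c; case gd: (good_dart d); last by rewrite /= !model_turn_bad.
have [->|->] := colour_cases true c.
  have step e : good_dart e ->
      model_turn true (model_turn false (e, true)) = (turn_back (turn_back e), true).
    move=> ge; rewrite (model_turn_other false) //.
    by rewrite (model_turn_other true) ?good_turn_back.
  by rewrite /= !step ?good_turn_back //; congr pair; exact: (iter8_turn_back gd).
have step e : good_dart e ->
    model_turn true (model_turn false (e, ~~ true)) = (turn (turn e), ~~ true).
  move=> ge; rewrite (model_turn_same false) //.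
  by rewrite (model_turn_same true) ?good_turn.
by rewrite /= !step ?good_turn //; congr pair; exact: (iter8_turn gd).
Qed.

Definition circle_level (k : nat) (b : bool) (j : nat) : nat :=
  if k is k'.+1 then
    if j < b.+1 then k' else if (j == b.+1) || (j == 7) then k else k.+1
  else 1.

Lemma size_reverse v j : good_dart (v, j) ->
  size (reverse (v, j)).1 = circle_level (size v) (two_parents v) j.
Proof.
move=> gx; have wv : word v by case/andP: gx.
case: (dartP gx) wv => {j gx} [u e ue wu|d w wv|u u0 wu|u u0 wu|u u0 wu|w w0].
- have wu' : word (e :: u) by rewrite /= ue.
  rewrite reverse_child //; move: ue; rewrite /circle_level /child_pos /block_size.
  case: u {wu wu'} => //= d w; rewrite /=; case: (_ && _) => /= ue.
    by do ?case: ifP => //; lia.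
  by do ?case: ifP => //; lia.
- by [].
- by rewrite reverse_next //= size_next; case: u u0 {wu} => //= d w _; case: (_ && _).
- rewrite reverse_prev //= size_prev /prev_pos; case: u u0 {wu} => //= d w _.
  by case: (_ && _).
- by rewrite reverse_last //= size_next; case: u u0 {wu} => //= d w _; case: (_ && _).
- move=> _; rewrite reverse_parent2 //= size_prev.
  by move/eqP: w0 => ->.
Qed.

End Model.

(** * Links and the developing map *)

Section AlternatingWalk.
Local Open Scope nat_scope.
Context {T : Type}.
Variable n : bool -> T -> T.

Fixpoint walk_alt (k : nat) (x : T) : T :=
  if k is k'.+1 then n (odd k') (walk_alt k' x) else x.

Fixpoint walk_back (k : nat) (x : T) : T :=
  if k is k'.+1 then walk_back k' (n (odd k') x) else x.

Hypothesis nK : forall k, involutive (n k).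

Lemma walk_altK k : cancel (walk_alt k) (walk_back k).
Proof. by elim: k => //= k IH x; rewrite nK IH. Qed.

Lemma walk_backK k : cancel (walk_back k) (walk_alt k).
Proof. by elim: k => //= k IH x; rewrite IH nK. Qed.

End AlternatingWalk.

(** * Two fixed-point-free involutions acting transitively on eight points *)

Section TransitiveDihedral.
Local Open Scope nat_scope.
Context {T : eqType}.
Variables (L : seq T) (n : bool -> T -> T).
Hypotheses (uniqL : uniq L)
  (n_in : forall k w, w \in L -> n k w \in L)
  (nK : forall k w, w \in L -> n k (n k w) = w)
  (n_fix : forall k w, w \in L -> n k w <> w)
  (n_trans : forall S : pred T, (exists2 w, w \in L & S w) ->
     (forall k w, w \in L -> S w -> S (n k w)) -> forall w, w \in L -> S w).

Lemma walk_alt_in k w : w \in L -> walk_alt n k w \in L.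
Proof. by move=> wL; elim: k => //= k; apply: n_in. Qed.

Lemma walk_alt_even k d w : w \in L -> ~~ odd d ->
  walk_alt n k w = walk_alt n (k + d) w -> w = walk_alt n d w.
Proof.
move=> wL ed; elim: k => // k IH /=; rewrite oddD (negbTE ed) addbF => E.
by apply: IH; rewrite -[LHS](nK (odd k)) ?walk_alt_in // E nK ?walk_alt_in.
Qed.

(** The step out of the earlier position and the step into the later one use the same involution, so
    an odd gap shrinks from both ends until a fixed point is left. *)
Lemma walk_alt_odd k d w : w \in L ->
  walk_alt n k w <> walk_alt n (k + d.*2.+1) w.
Proof.
move=> wL; elim: d k => [|d IH] k E.
  move: E; rewrite addn1 /= => /esym; exact/n_fix/walk_alt_in.
apply: (IH k.+1).
have -> : k.+1 + d.*2.+1 = k + d.*2.+2 by lia.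
have {}E : walk_alt n k w = n (odd k) (walk_alt n (k + d.*2.+2) w).
  rewrite E; have -> : k + d.+1.*2.+1 = (k + d.*2.+2).+1 by lia.
  by rewrite [LHS]/= oddD /= odd_double addbF.
by rewrite [LHS]/= E nK // walk_alt_in.
Qed.

(* A closed alternating walk is invariant under both involutions, hence runs through [L]. *)
Lemma walk_alt_period d w : w \in L -> 0 < d -> ~~ odd d -> w = walk_alt n d w ->
  {subset L <= mkseq (walk_alt n ^~ w) d}.
Proof.
move=> wL d0 ed E; apply: (n_trans (S := mem (mkseq (walk_alt n ^~ w) d))).
  by exists w => //; apply/mapP; exists 0; rewrite ?mem_iota.
have inS i : i < d -> walk_alt n i w \in mkseq (walk_alt n ^~ w) d.
  by move=> id; apply/mapP; exists i; rewrite ?mem_iota.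
have inS0 : walk_alt n d w \in mkseq (walk_alt n ^~ w) d by rewrite -E; apply: (inS 0).
move=> k x xL /mapP[i]; rewrite mem_iota /= add0n => id ->.
have [->|ki] := eqVneq k (odd i).
  move: id; rewrite leq_eqVlt => /orP[/eqP di|id].
    by have -> : n (odd i) (walk_alt n i w) = walk_alt n d w by rewrite -di.
  exact: (inS i.+1).
case: i => [|i] in id ki *.
  have -> : walk_alt n 0 w = n (odd d.-1) (walk_alt n d.-1 w).
    by transitivity (walk_alt n d w) => //; case: (d) d0.
  have <- : k = odd d.-1.
    by move: ed ki => /=; case: (d) d0 => //= d' _; case: k (odd d') => -[].
  by rewrite nK ?walk_alt_in //; apply: inS; rewrite ltn_predL.
have -> : k = odd i by move: ki => /=; case: k (odd i) => -[].
by rewrite /= nK ?walk_alt_in // inS // ltnW.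
Qed.

(** Among nine positions two coincide. Their gap is even, so the walk closes up after that many
    steps; by transitivity it then covers [L], which forces the gap to be 8. *)
Lemma walk_alt_cycle w : size L = 8 -> w \in L ->
  [/\ walk_alt n 8 w = w, uniq (mkseq (walk_alt n ^~ w) 8) &
      mkseq (walk_alt n ^~ w) 8 =i L].
Proof.
move=> L8 wL; set s := mkseq _ 8.
have subL d : {subset mkseq (walk_alt n ^~ w) d <= L}.
  by move=> x /mapP[i _ ->]; apply: walk_alt_in.
suff E : w = walk_alt n 8 w.
  have sub := walk_alt_period wL (isT : 0 < 8) isT E.
  have szs : size s <= size L by rewrite size_mkseq L8.
  split=> //; first exact: (leq_size_uniq uniqL sub).
  by move=> x; apply/idP/idP => [/subL|/sub].
have : ~~ uniq (mkseq (walk_alt n ^~ w) 9).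
  by apply/negP => /uniq_leq_size /(_ (subL 9)); rewrite size_mkseq L8.
case/(uniqPn w) => i [j [ij]]; rewrite size_mkseq => j9.
rewrite !nth_mkseq ?(ltn_trans ij) // => eij.
have [od|ed] := boolP (odd (j - i)).
  exfalso; apply: (@walk_alt_odd i (j - i)./2 w wL); rewrite eij.
  by congr (walk_alt n _ w); move: (odd_double_half (j - i)); rewrite od; lia.
have E : w = walk_alt n (j - i) w.
  by apply: (@walk_alt_even i) => //; rewrite subnKC // ltnW.
have d0 : 0 < j - i by rewrite subn_gt0.
have := uniq_leq_size uniqL (walk_alt_period wL d0 ed E).
rewrite size_mkseq L8 => d8.
by have <- : j - i = 8 by lia.
Qed.

End TransitiveDihedral.

Lemma cardfs_sep (T : choiceType) (A : {fset T}) (P : pred T) :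
  #|` [fset t in A | P t]%fset| = (\sum_(t <- A) P t)%N.
Proof.
by rewrite card_fset_sum1 big_fset [LHS]big_mkcond; apply: eq_bigr => t _; case: (P t).
Qed.

(** * Counting triangles at an edge *)

Section Links.
Local Open Scope classical_set_scope.
Local Open Scope fset_scope.
Local Open Scope nat_scope.
Context {R : realType} {V : choiceType}.
Variables (K : set {fset V}) (black : {fset V} -> bool).
Hypothesis HK : is_H28 R K black.
Implicit Types (u v w x y : V) (k : bool).

Definition adjacent u w := edge K [fset u; w].

Definition coloured_triangle k u w x :=
  triangle K [fset u; w; x] /\ black [fset u; w; x] = k.

Let SC : simplicial_2complex K := (H28_plane HK).1.

Lemma adjacentC u w : adjacent u w -> adjacent w u.
Proof. by rewrite /adjacent fsetUC. Qed.

Lemma adjacent_neq u w : adjacent u w -> u != w.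
Proof. by case=> _; rewrite cardfs2; case: eqP. Qed.

Lemma adjacentP u w : adjacent u w <-> K [fset u; w] /\ u != w.
Proof.
split=> [a|[Kuw uw]]; first by split; [case: a|exact: adjacent_neq].
by split=> //; rewrite cardfs2 uw.
Qed.

Lemma adjacent_simplex s u w : K s -> u \in s -> w \in s -> u != w -> adjacent u w.
Proof.
move=> Ks us ws uw; apply/adjacentP; split=> //; apply: (sc_face SC Ks).
  by apply/fsubsetP => x; rewrite !inE => /orP[]/eqP->.
by apply/fset0Pn; exists u; rewrite !inE eqxx.
Qed.

Lemma cardfs3 u w x : #|` [fset u; w; x]| = 3 <-> [/\ u != w, u != x & w != x].
Proof.
rewrite fsetUC cardfsU1 cardfs2 !inE negb_or ![_ == x]eq_sym.
case: (u == w); case: (x == u); case: (x == w); split=> //=; case=> //.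
Qed.

Lemma coloured_triangleP k u w x : coloured_triangle k u w x ->
  [/\ adjacent u w, adjacent u x & adjacent w x].
Proof.
move=> [[Kt /cardfs3[uw ux wx]] _].
by split; apply: (adjacent_simplex Kt); rewrite // !inE eqxx ?orbT.
Qed.

Lemma coloured_triangleCl k u w x : coloured_triangle k u w x -> coloured_triangle k w u x.
Proof. by rewrite /coloured_triangle [in X in X -> _](fsetUC [fset u]). Qed.

Lemma coloured_triangleCr k u w x : coloured_triangle k u w x -> coloured_triangle k u x w.
Proof. by rewrite /coloured_triangle -!fsetUA [in X in X -> _](fsetUC [fset w]). Qed.

Lemma triangle_third t u w : #|` t| = 3 -> u \in t -> w \in t -> u != w ->
  exists x, t = [fset u; w; x].
Proof.
move=> t3 ut wt uw.
have : #|` t `\` [fset u; w]| = 1.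
  rewrite cardfsDS ?t3 ?cardfs2 ?uw //.
  by apply/fsubsetP => x; rewrite !inE => /orP[]/eqP->.
move/eqP/cardfs1P => [x tx]; exists x.
by rewrite -tx fsetUDl fsetDv fsetD0; apply/esym/fsetUidPr/fsubsetP => y;
  rewrite !inE => /orP[]/eqP->.
Qed.

(** Two distinct triangles on one edge meet exactly in that edge, so their colours differ. *)
Lemma coloured_triangle_unique k u w x y :
  coloured_triangle k u w x -> coloured_triangle k u w y -> x = y.
Proof.
move=> [Tx bx] [Ty by_]; apply/eqP/negPn/negP => xy.
have [_ /cardfs3[uw ux wx]] := Tx; have [_ /cardfs3[_ uy wy]] := Ty.
have : #|` [fset u; w; x] `&` [fset u; w; y]| = 2.
  rewrite -fsetUIr (_ : [fset x] `&` [fset y] = fset0) ?fsetU0 ?cardfs2 ?uw //.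
  by apply/fsetP => z; rewrite !inE; case: eqVneq => [->|//]; rewrite (negbTE xy).
by move/(H28_colour HK Tx Ty); rewrite bx by_; case: (k).
Qed.

Definition star_edges u : {fset {fset V}} := fset_set [set e | edge K e /\ u \in e].
Definition star_triangles u : {fset {fset V}} := fset_set [set t | triangle K t /\ u \in t].
Definition link u : {fset V} := locked ((\bigcup_(e <- star_edges u) e) `\ u).

Lemma finite_star_edges u : finite_set [set e | edge K e /\ u \in e].
Proof. by exists 8; apply: H28_edges HK _. Qed.

Lemma finite_star_triangles u : finite_set [set t | triangle K t /\ u \in t].
Proof. by exists 8; apply: H28_triangles HK _. Qed.

Lemma in_star_edges u e : (e \in star_edges u) <-> edge K e /\ u \in e.
Proof. by rewrite /star_edges in_fset_set ?inE //; exact: finite_star_edges. Qed.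

Lemma in_star_triangles u t : (t \in star_triangles u) <-> triangle K t /\ u \in t.
Proof. by rewrite /star_triangles in_fset_set ?inE //; exact: finite_star_triangles. Qed.

Lemma in_link u w : (w \in link u) <-> adjacent u w.
Proof.
rewrite /link -lock in_fsetD1; split=> [/andP[wu]|a].
  case/bigfcupP => e /andP[/in_star_edges[[Ke _] ue] _] we.
  by apply: adjacent_simplex Ke _ _ _; rewrite // eq_sym.
rewrite eq_sym adjacent_neq //=; apply/bigfcupP; exists [fset u; w].
  by rewrite andbT; apply/in_star_edges; split=> //; rewrite !inE eqxx.
by rewrite !inE eqxx orbT.
Qed.

Lemma card_link u : #|` link u| = 8.
Proof.
have <- : #|` star_edges u| = 8 by exact: (card_fset_set (H28_edges HK u)).
have -> : star_edges u = [fset [fset u; w] | w in link u].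
  apply/fsetP => e; apply/idP/imfsetP => [/in_star_edges[[Ke e2] ue]|[w /= /in_link a ->]].
    have : #|` e `\ u| = 1 by move: e2; rewrite (cardfsD1 u) ue => -[].
    move/eqP/cardfs1P => [w ew]; exists w.
      apply/in_link; have := in_fset1 w w; rewrite -ew eqxx !inE => /andP[wu we].
      by apply: adjacent_simplex Ke _ _ _; rewrite // eq_sym.
    by rewrite -ew fsetD1K.
  by apply/in_star_edges; split=> //; rewrite !inE eqxx.
apply/esym; rewrite card_in_imfset // => w x /in_link/adjacent_neq uw _ /fsetP/(_ w).
by rewrite !inE eqxx orbT eq_sym (negbTE uw) /= => /esym/eqP.
Qed.

(* Each edge lies in at most two triangles, by the colouring, and the average is two. *)
Lemma coloured_triangle_exists k u w : adjacent u w -> exists x, coloured_triangle k u w x.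
Proof.
move=> a; pose N w := \sum_(t <- star_triangles u) (w \in t : nat).
have N2 x : x \in link u -> N x <= 2.
  move=> /in_link/adjacent_neq ux.
  have -> : N x = #|` [fset t in star_triangles u | x \in t]|.
    by rewrite cardfs_sep.
  have inj : {in [fset t in star_triangles u | x \in t] &, injective black}.
    move=> s t; rewrite !inE /= => /andP[/in_star_triangles[Ts us] xs].
    move=> /andP[/in_star_triangles[Tt ut] xt] bst.
    have [y sy] := triangle_third Ts.2 us xs ux.
    have [z tz] := triangle_third Tt.2 ut xt ux.
    rewrite sy tz; congr ([fset u; x] `|` [fset _]).
    by apply: (@coloured_triangle_unique (black s) u x);
      split; rewrite -?sy -?tz.
  rewrite -(size_map black).
  apply: (@uniq_leq_size _ _ [:: true; false]) => [|[]] //.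
  by rewrite map_inj_in_uniq ?fset_uniq.
(* Each of the 8 triangles at [u] has two further vertices. *)
have sumN : \sum_(x <- link u) N x = 16.
  rewrite exchange_big /=.
  transitivity (\sum_(t <- star_triangles u) 2).
    rewrite big_seq [RHS]big_seq; apply: eq_bigr => t /in_star_triangles[[Kt t3] ut].
    have <- : #|` t `\ u| = 2 by move: t3; rewrite (cardfsD1 u) ut => -[].
    have -> : t `\ u = [fset x in link u | x \in t].
      apply/fsetP => x; rewrite !inE /=; apply/andP/andP => [[xu xt]|[/in_link xl xt]].
        by split=> //; apply/in_link/(adjacent_simplex Kt); rewrite // eq_sym.
      by split=> //; rewrite eq_sym; apply: adjacent_neq.
    by rewrite cardfs_sep.
  rewrite big_const_seq count_predT iter_addn_0.
  have -> : size (star_triangles u) = 8.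
    exact: (card_fset_set (H28_triangles HK u)).
  by [].
have wl : w \in link u by apply/in_link.
(* The 7 other terms contribute at most 14 of the 16. *)
have Nw : 2 <= N w.
  have le14 : \sum_(x <- link u `\ w) N x <= 14.
    apply: (@leq_trans (\sum_(x <- link u `\ w) 2)).
      rewrite big_seq [leqRHS]big_seq; apply: leq_sum => x.
      by rewrite !inE => /andP[_ /N2].
    rewrite big_const_seq count_predT iter_addn_0.
    have -> : size (link u `\ w) = 7.
      by have := card_link u; rewrite (cardfsD1 w) wl => -[].
    by [].
  by move: sumN; rewrite (big_fsetD1 w) //=; lia.
have uw := adjacent_neq a.
have [t [tT wt bt]] : exists t, [/\ t \in star_triangles u, w \in t & black t = k].
  apply: contrapT => no.
  have : N w <= 1; last by lia.
  have -> : N w = #|` [fset t in star_triangles u | w \in t]|.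
    by rewrite cardfs_sep.
  have nk t : t \in [fset t in star_triangles u | w \in t] -> black t = ~~ k.
    rewrite !inE => /andP[tT wt].
    have : black t <> k by move=> bt; apply: no; exists t.
    by case: (black t) (k) => -[].
  rewrite leqNgt; apply/negP => gt1.
  have [s sF] : exists s, s \in [fset t in star_triangles u | w \in t].
    by apply/fset0Pn; rewrite -cardfs_gt0 ltnW.
  have [t tF] : exists t, t \in [fset t in star_triangles u | w \in t] `\ s.
    apply/fset0Pn; rewrite -cardfs_gt0; move: gt1.
    by rewrite (cardfsD1 s) sF.
  move: tF; rewrite in_fsetD1 => /andP[ts tF].
  have := nk _ sF; have := nk _ tF.
  move: sF tF; rewrite !inE => /andP[/in_star_triangles[Ts us] ws].
  move=> /andP[/in_star_triangles[Tt ut] wt] bt bs.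
  have [y sy] := triangle_third Ts.2 us ws uw.
  have [z tz] := triangle_third Tt.2 ut wt uw.
  case/eqP: ts; rewrite sy tz; congr ([fset u; w] `|` [fset _]).
  by apply: (@coloured_triangle_unique (~~ k) u w); split; rewrite -?sy -?tz.
have [[Kt t3] ut] := (in_star_triangles u t).1 tT.
have [x tx] := triangle_third t3 ut wt uw.
by exists x; split; rewrite -tx.
Qed.

End Links.

(** * Connected links and the developing map on darts *)

Section Developing.
Local Open Scope classical_set_scope.
Local Open Scope fset_scope.
Local Open Scope nat_scope.
Context {R : realType} {V : choiceType}.
Variables (K : set {fset V}) (black : {fset V} -> bool).
Hypothesis HK : is_H28 R K black.
Implicit Types (u v w : V) (k : bool).

Local Notation adjacent := (adjacent K).
Local Notation coloured_triangle := (coloured_triangle K black).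
Local Notation link := (link K).

Let SC : simplicial_2complex K := (H28_plane HK).1.

(* Away from the edges the junk value of [third k u w] is [w]. *)
Definition third k u w : V := xget w (coloured_triangle k u w).

Lemma third_triangle k u w : adjacent u w -> coloured_triangle k u w (third k u w).
Proof. by move=> /(coloured_triangle_exists HK k)[x Hx]; exact: (xgetPex w (ex_intro _ x Hx)). Qed.

Lemma third_eq k u w x : coloured_triangle k u w x -> third k u w = x.
Proof.
move=> T; have [a _ _] := coloured_triangleP HK T.
exact: (coloured_triangle_unique HK (third_triangle k a) T).
Qed.

Lemma thirdK k u w : adjacent u w -> third k u (third k u w) = w.
Proof. by move=> a; apply/third_eq/coloured_triangleCr/third_triangle. Qed.

Lemma third_neq k u w : adjacent u w -> third k u w <> w.
Proof.
move=> /(third_triangle k)/(coloured_triangleP HK)[_ _ /adjacent_neq/eqP H] e.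
exact: H.
Qed.

Lemma adjacent_third k u w : adjacent u w -> adjacent u (third k u w).
Proof. by move=> /(third_triangle k)/(coloured_triangleP HK)[]. Qed.

(* If the link of [u] split into two invariant parts, the bundle twisted along the edges
   towards one part would have a section although [u] is not a cut vertex. *)
Lemma link_connected u (S : pred V) : (exists2 w, adjacent u w & S w) ->
  (forall k w, adjacent u w -> S w -> S (third k u w)) ->
  forall w, adjacent u w -> S w.
Proof.
move=> [w0 a0 S0] closed w aw; apply: contraT => Sw.
pose S' z := S z && (z != u).
(* A double cover whose sheets are exchanged exactly along the edges from [u] to the part [S]. *)
pose chi a b := ((a == u) && S' b) (+) ((b == u) && S' a).
pose tau a b (x : bool) := x (+) chi a b.
have const s a b : K s -> u \in s -> a \in s -> b \in s -> a != u -> b != u -> S a = S b.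
  suff main c d : K s -> u \in s -> c \in s -> d \in s -> c != u -> d != u -> S c -> S d.
    by move=> Ks us as_ bs au bu; apply/idP/idP; apply: main.
  move=> Ks us cs ds cu du Sc; have [<-//|cd] := eqVneq c d.
  have ac : adjacent u c by apply: (adjacent_simplex HK Ks); rewrite // eq_sym.
  have T : coloured_triangle (black [fset u; c; d]) u c d.
    split=> //; split; last by apply/cardfs3; rewrite cd ![u == _]eq_sym.
    apply: (sc_face SC Ks).
      by apply/fsubsetP => z; rewrite !inE => /orP[/orP[]|]/eqP->.
    by apply/fset0Pn; exists u; rewrite !inE eqxx.
  by rewrite -(third_eq T); apply: closed.
have [||sec _ Hsec] := exists_flat_section (H28_plane HK) (tau := tau) u true.
- by move=> z x; rewrite /tau /chi addbb addbF.
- move=> s a b c x Ks as_ bs cs; rewrite /tau -addbA; congr addb.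
  have [us|us] := boolP (u \in s).
    have chiE a' b' : a' \in s -> b' \in s ->
        chi a' b' = ((a' == u) (+) (b' == u)) && (if a' == u then S' b' else S' a').
      rewrite /chi /S' => _ _; case: (eqVneq a' u) => [->|an]; rewrite ?eqxx ?andbF ?addbF //=.
      by case: (eqVneq b' u) => [->|bn]; rewrite ?eqxx ?andbF //= ?addbF.
    have Sab a' b' : a' \in s -> b' \in s -> a' != u -> b' != u -> S' a' = S' b'.
      by move=> a's b's an bn; rewrite /S' an bn (const s a' b').
    have S'u : S' u = false by rewrite /S' eqxx andbF.
    rewrite !chiE //; case: (eqVneq a u) => [ea|an]; case: (eqVneq b u) => [eb|bn];
      case: (eqVneq c u) => [ec|cn]; rewrite ?ea ?eb ?ec ?S'u //=; rewrite ?addbF ?addbb //.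
    + exact: Sab.
    + by rewrite (Sab a c) ?addbb.
    + exact: Sab.
  have chi0 a' b' : a' \in s -> b' \in s -> chi a' b' = false.
    move=> a's b's; rewrite /chi.
    have -> : (a' == u) = false by apply/negbTE; apply: contraNneq us => <-.
    by have -> : (b' == u) = false by apply/negbTE; apply: contraNneq us => <-.
  by rewrite !chi0.
have out a b : K [fset a; b] -> a <> u -> b <> u -> sec a = sec b.
  move=> Kab /eqP an /eqP bn.
  by rewrite (Hsec _ _ Kab) /tau /chi (negbTE an) (negbTE bn) addbF.
have nu z : adjacent u z -> z <> u.
  by move=> /adjacent_neq zu zz; rewrite zz eqxx in zu.
(* Away from [u] the section is constant, but the edges from [u] to [w0] and to [w] prescribe
   different values. *)
have := no_cut_vertex (H28_plane HK) out (nu _ a0) (nu _ aw).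
have [/adjacentP[K0 _] /adjacentP[K1 _]] := (a0, aw).
rewrite (Hsec _ _ K0) (Hsec _ _ K1) /tau /chi eqxx /S' S0 (negbTE Sw) /=.
have -> : w0 != u by apply/eqP; exact: nu.
have -> : (w0 == u) = false by apply/eqP; exact: nu.
have -> : (w == u) = false by apply/eqP; exact: nu.
by rewrite addbF addbT; case: (sec u).
Qed.

(** Once [u] is replaced by a neighbour, both vertices avoid [u], and [u] is not a cut vertex. *)
Lemma connected_const (T : Type) (F : V -> T) :
  (forall u w, adjacent u w -> F u = F w) -> forall u w, F u = F w.
Proof.
move=> Fe u w; have [->//|wu] := eqVneq w u.
have [x xl] : exists x, x \in link u by apply/fset0Pn; rewrite -cardfs_gt0 (card_link HK).
have ax : adjacent u x by apply/(in_link HK).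
rewrite (Fe _ _ ax); apply: (no_cut_vertex (H28_plane HK) (v := u)).
- move=> a b Kab au bu; have [->//|ab] := eqVneq a b.
  by apply: Fe; apply/adjacentP.
- by move=> xu; move: (adjacent_neq ax); rewrite xu eqxx.
- exact/eqP.
Qed.

Definition first_neighbour u : V := nth u (link u) 0.

Definition link_cycle u : seq V := mkseq (fun i => walk_alt (third ^~ u) i (first_neighbour u)) 8.

Definition link_index u w : nat := index w (link_cycle u).

Lemma link_cycleP u :
  [/\ walk_alt (third ^~ u) 8 (first_neighbour u) = first_neighbour u,
      uniq (link_cycle u) & link_cycle u =i link u].
Proof.
apply: walk_alt_cycle; rewrite ?(card_link HK) ?fset_uniq //.
- by move=> k w /(in_link HK) a; apply/(in_link HK)/adjacent_third.
- by move=> k w /(in_link HK); apply: thirdK.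
- by move=> k w /(in_link HK); apply: third_neq.
- move=> S [w /(in_link HK) a Sw] closed z /(in_link HK).
  apply: link_connected; first by exists w.
  by move=> k y /(in_link HK); apply: closed.
- by apply: mem_nth; rewrite (card_link HK).
Qed.

Section Transport.
Variables (X : Type) (n : bool -> X -> X) (A : X -> X).
Hypotheses (nK : forall k, involutive (n k)) (AK : involutive A)
  (nA3 : forall k x, A (n k (A (n k (A (n k x))))) = x)
  (n8 : forall x, iter 4 (fun y => n true (n false y)) x = x).

(* An element of [X] over [u] stands for a map from the darts at [u] to [X] compatible with
   the two involutions, given by its value at the first neighbour. *)
Definition dart_value u (x : X) w : X := walk_alt n (link_index u w) x.

(** Fixed by the demand that the dart from [v] back to [u] receive the flipped value. The default
    makes the transport from a vertex to itself the identity. *)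
Definition transport u v (x : X) : X :=
  if `[< adjacent u v >] then walk_back n (link_index v u) (A (dart_value u x v)) else x.

(** Inside the cycle this is the definition of the walk; between the positions 7 and 0 it holds
    because [n8] closes the walk in [X] after eight steps, as the link does. *)
Lemma dart_value_third k u w x : adjacent u w ->
  dart_value u x (third k u w) = n k (dart_value u x w).
Proof.
move=> a; have [per un cyc] := link_cycleP u.
have : w \in link_cycle u by rewrite cyc; apply/(in_link HK).
set e := fun i => walk_alt (third ^~ u) i (first_neighbour u).
have e8 : e 8 = e 0 by [].
have x8 : walk_alt n 8 x = x := n8 x.
have idx i : i < 8 -> link_index u (e i) = i.
  by move=> i8; rewrite /link_index -[e i](nth_mkseq u e (n := 8)) // index_uniq // size_mkseq.
have adj i : adjacent u (e i).
  apply/(in_link HK); elim: i => [|i /(in_link HK) ai].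
    by apply: mem_nth; rewrite (card_link HK).
  by apply/(in_link HK)/adjacent_third.
case/mapP => i; rewrite mem_iota /= add0n => i8 ->; rewrite -/(e i) /dart_value (idx i) //.
have [->|ki] := eqVneq k (odd i).
  have -> : third (odd i) u (e i) = e i.+1 by [].
  move: i8; rewrite leq_eqVlt => /orP[/eqP[->]|i8]; last by rewrite (idx i.+1).
  by rewrite e8 (idx 0) //= -[in LHS]x8.
case: i => [|i] in i8 ki *.
  have -> : k = odd 7 by move: ki; case: (k).
  have -> : third (odd 7) u (e 0) = e 7.
    by rewrite -e8 [e 8]/= thirdK //; exact: (adj 7).
  rewrite (idx 7) // -[walk_alt n 0 x]/x -[in RHS]x8.
  by rewrite [walk_alt n 8 x]/= nK.
have -> : k = odd i by move: ki => /=; case: (k) (odd i) => -[].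
have -> : third (odd i) u (e i.+1) = e i by rewrite [e i.+1]/= thirdK //; exact: (adj i).
by rewrite (idx i) 1?ltnW //= nK.
Qed.

Lemma dart_value_transport u v x : adjacent u v ->
  dart_value v (transport u v x) u = A (dart_value u x v).
Proof.
by move=> a; rewrite /transport asboolT // /dart_value (walk_backK nK).
Qed.

Lemma dart_value_inj u w x y : dart_value u x w = dart_value u y w -> x = y.
Proof. exact: (can_inj (walk_altK nK (link_index u w))). Qed.

Lemma transport_id u x : transport u u x = x.
Proof. by rewrite /transport asboolF // => /adjacent_neq; rewrite eqxx. Qed.

(** For a triangle of colour [k] both sides are compared on the dart from [w] to [u], where the
    identity becomes the relation [nA3]; going along an edge and back uses [AK]. *)
Lemma transport_comp s u v w x : K s -> u \in s -> v \in s -> w \in s ->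
  transport v w (transport u v x) = transport u w x.
Proof.
move=> Ks us vs ws.
have [<-|uv] := eqVneq u v; first by rewrite transport_id.
have [<-|vw] := eqVneq v w; first by rewrite transport_id.
have auv : adjacent u v := adjacent_simplex HK Ks us vs uv.
have avw : adjacent v w := adjacent_simplex HK Ks vs ws vw.
have [<-|uw] := eqVneq u w.
  have avu := adjacentC auv.
  apply: (@dart_value_inj u v); rewrite transport_id.
  by rewrite dart_value_transport // dart_value_transport // AK.
have auw : adjacent u w := adjacent_simplex HK Ks us ws uw.
have T : coloured_triangle (black [fset u; v; w]) u v w.
  split=> //; split; last by apply/cardfs3.
  apply: (sc_face SC Ks).
    by apply/fsubsetP => z; rewrite !inE => /orP[/orP[]|]/eqP->.
  by apply/fset0Pn; exists u; rewrite !inE eqxx.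
move: (black _) T => k T.
have e1 : third k u v = w := third_eq T.
have e2 : third k v u = w by apply/third_eq/coloured_triangleCl.
have e3 : third k w v = u.
  by apply/third_eq/coloured_triangleCl/coloured_triangleCr/coloured_triangleCl.
apply: (@dart_value_inj w u).
rewrite [RHS]dart_value_transport // -[in RHS]e1 dart_value_third //.
rewrite -[in LHS]e3 dart_value_third; last exact: adjacentC.
rewrite e3 dart_value_transport // -[in LHS]e2 dart_value_third; last exact: adjacentC.
rewrite dart_value_transport //; set y := dart_value u x v.
have E z : n k (A (n k z)) = A (n k (A z)).
  by rewrite -[in RHS](nA3 k (n k (A z))) nK !AK.
by rewrite E AK.
Qed.

Lemma exists_dart_map o w (x0 : X) : adjacent o w ->
  exists2 Phi : V -> V -> X, Phi o w = x0 &
    forall u v, adjacent u v -> Phi v u = A (Phi u v) /\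
      forall k, Phi u (third k u v) = n k (Phi u v).
Proof.
move=> aw.
have [sec sec0 Hsec] := exists_flat_section (H28_plane HK) o
  (walk_back n (link_index o w) x0) transport_id transport_comp.
exists (fun u => dart_value u (sec u)) => [|u v a].
  by rewrite sec0 /dart_value (walk_backK nK).
split=> [|k]; last exact: dart_value_third.
by have /adjacentP[/Hsec -> _] := a; rewrite dart_value_transport.
Qed.

End Transport.

End Developing.

(** * Pulling the local picture back from the model *)

Section CircularStructure.
Local Open Scope classical_set_scope.
Local Open Scope fset_scope.
Local Open Scope nat_scope.
Context {R : realType} {V : choiceType}.
Variables (K : set {fset V}) (black : {fset V} -> bool).

(* [nbr u] runs around the link of [u], starting at a parent; [lev] is the distance to [o], and
   [tp u] tells whether [u] has two parents (irrelevant for [u = o]). *)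
Record circular_structure (o : V) (nbr : V -> nat -> V) (lev : V -> nat)
    (tp col : V -> bool) : Prop := {
  cs_adjacent : forall u j, j < 8 -> adjacent K u (nbr u j);
  cs_surj : forall u w, adjacent K u w -> exists2 j, j < 8 & w = nbr u j;
  cs_inj : forall u i j, i < 8 -> j < 8 -> nbr u i = nbr u j -> i = j;
  cs_triangle : forall u j, j < 8 ->
    coloured_triangle K black (col u (+) odd j) u (nbr u j) (nbr u ((j + 1) %% 8));
  cs_level : forall u j, j < 8 -> lev (nbr u j) = circle_level (lev u) (tp u) j;
  cs_root : lev o = 0
}.

Hypothesis HK : is_H28 R K black.

Lemma model_turn_word k x : (model_turn k x).1.1 = x.1.1.
Proof. by rewrite /model_turn; case: ifP => //= _; case: ifP. Qed.

Lemma model_turn_goodE k x : good_dart (model_turn k x).1 = good_dart x.1.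
Proof.
rewrite /model_turn; case: ifP => //= gx.
by case: ifP; rewrite ?good_turn ?good_turn_back ?gx.
Qed.

Lemma model_flip_goodE x : good_dart (model_flip x).1 = good_dart x.1.
Proof. by rewrite /model_flip; case: ifP => //= gx; rewrite good_reverse ?gx. Qed.

Theorem exists_circular_structure (o : V) :
  exists nbr lev tp col, circular_structure o nbr lev tp col.
Proof.
pose fn := first_neighbour K.
have afn u : adjacent K u (fn u).
  by apply/(in_link HK)/mem_nth; rewrite (card_link HK).
(* The colour [false] is a free choice: it selects one of the two orientations. *)
have [Phi Phi0 HPhi] := exists_dart_map HK model_turnK model_flipK model_face model_round
  (([::], 0), false) (afn o).
have PhiT u v k : adjacent K u v -> Phi u (third K black k u v) = model_turn k (Phi u v).
  by move=> /HPhi[].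
have PhiF u v : adjacent K u v -> Phi v u = model_flip (Phi u v) by move=> /HPhi[].
(* Turns and flips preserve good darts, so connected links and the connectedness of [K] carry
   goodness from the starting dart to all others. *)
have good u v : adjacent K u v -> good_dart (Phi u v).1.
  have gconst u' v' : adjacent K u' v' ->
      good_dart (Phi u' v').1 = good_dart (Phi u' (fn u')).1.
    move=> a; apply/eqP; move: v' a.
    apply: (link_connected HK (S := fun w => good_dart (Phi u' w).1 == _)).
      by exists (fn u').
    by move=> k w aw; rewrite PhiT // model_turn_goodE.
  move=> a; rewrite gconst //.
  have := connected_const HK (F := fun u => good_dart (Phi u (fn u)).1) _ u o.
  rewrite Phi0 => -> // x y axy.
  by rewrite -(gconst _ _ axy) -(gconst _ _ (adjacentC axy)) (PhiF _ _ axy) model_flip_goodE.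
pose W u := (Phi u (fn u)).1.1.
have WE u v : adjacent K u v -> (Phi u v).1.1 = W u.
  move=> a; apply/eqP; move: v a.
  apply: (link_connected HK (S := fun w => (Phi u w).1.1 == W u)).
    by exists (fn u).
  by move=> k w aw; rewrite PhiT // model_turn_word.
pose pos u v := (Phi u v).1.2.
(* Using the colour stored in the dart itself always turns forward, so all eight positions are
   reached. *)
have next u v : adjacent K u v -> let w := third K black (Phi u v).2 u v in
    [/\ adjacent K u w, pos u w = (pos u v + 1) %% 8 & (Phi u w).2 = ~~ (Phi u v).2].
  move=> a w; have gd := good _ _ a; rewrite /pos /w PhiT //.
  split; first exact: (adjacent_third HK).
    by case: (Phi u v) gd => d c /= gd; rewrite model_turn_same.
  by case: (Phi u v) gd => d c /= gd; rewrite model_turn_same.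
have all_pos u j : j < 8 -> exists v, adjacent K u v /\ pos u v = j.
  move=> j8.
  have step i : exists v, adjacent K u v /\ pos u v = (pos u (fn u) + i) %% 8.
    elim: i => [|i [v [av pv]]].
      exists (fn u); split=> //; rewrite addn0 modn_small //.
      by have /andP[] := good _ _ (afn u).
    have [aw pw _] := next u v av; exists (third K black (Phi u v).2 u v); split=> //.
    by rewrite pw pv modnDml -addnA addn1.
  have [v [av pv]] := step (j + (8 - pos u (fn u))).
  have p8 : pos u (fn u) < 8 by have /andP[] := good _ _ (afn u).
  exists v; split=> //; rewrite pv; lia.
have /boolp.choice[nb Hnb] : forall uj : V * nat, exists v,
    uj.2 < 8 -> adjacent K uj.1 v /\ pos uj.1 v = uj.2.
  move=> [u j] /=; case: (ltnP j 8) => [/(all_pos u)[v Hv]|_]; first by exists v.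
  by exists u.
pose nbr u j := nb (u, j).
have adj u j : j < 8 -> adjacent K u (nbr u j) by move=> j8; case: (Hnb (u, j) j8).
have posE u j : j < 8 -> pos u (nbr u j) = j by move=> j8; case: (Hnb (u, j) j8).
have inj u i j : i < 8 -> j < 8 -> nbr u i = nbr u j -> i = j.
  by move=> i8 j8 e; rewrite -(posE u i) // e posE.
have surj u w : adjacent K u w -> exists2 j, j < 8 & w = nbr u j.
  move=> a; pose s := mkseq (nbr u) 8.
  have us : uniq s.
    apply/mkseq_uniqP => i j; rewrite !inE => i8 j8; exact: inj.
  have ss : {subset s <= link K u}.
    by move=> x /mapP[j]; rewrite mem_iota => /= j8 ->; apply/(in_link HK)/adj.
  have sz : size (link K u) <= size s by rewrite size_mkseq (card_link HK).
  have [_ E] := uniq_min_size us ss sz.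
  have : w \in s by rewrite E; apply/(in_link HK).
  by case/mapP => j; rewrite mem_iota => /= j8 ->; exists j.
have posK u v : adjacent K u v -> nbr u (pos u v) = v.
  by move=> /surj[j j8 ->]; rewrite posE.
have nextE u j : j < 8 ->
    third K black (Phi u (nbr u j)).2 u (nbr u j) = nbr u ((j + 1) %% 8).
  by move=> j8; have [aw pw _] := next u _ (adj u j j8); rewrite -(posK _ _ aw) pw posE.
pose col u := (Phi u (nbr u 0)).2.
have colE u j : j < 8 -> (Phi u (nbr u j)).2 = col u (+) odd j.
  elim: j => [_|j IH j8]; first by rewrite addbF.
  have j8' : j < 8 by apply: ltnW.
  have [_ _] := next u _ (adj u j j8').
  by rewrite nextE // modn_small addn1 // IH // => ->; rewrite /= addbN.
exists nbr, (fun u => size (W u)), (fun u => two_parents (W u)), col.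
split=> //.
- by move=> u j j8; rewrite -colE // -nextE //; apply: (third_triangle HK); apply: adj.
- move=> u j j8; have a := adj u j j8; have gd := good _ _ a.
  rewrite -(WE _ _ (adjacentC a)) PhiF // -size_reverse; last first.
    by move: gd; rewrite /good_dart (WE _ _ a); have := posE u j j8; rewrite /pos => ->.
  have -> : (W u, j) = (Phi u (nbr u j)).1.
    have := WE _ _ a; have := posE u j j8; rewrite /pos.
    by case: (Phi u (nbr u j)).1 => v i /= -> ->.
  by rewrite /model_flip gd.
- by rewrite /W Phi0.
Qed.

End CircularStructure.

(** * Linear algebra *)

Section FunctionSpaces.
Context {F : fieldType}.

(** Linear map of a 0-1 matrix. It serves for the constraints, for restriction to a subset, for
    evaluation at a point and for placing coefficients at chosen unknowns. *)
Definition incidence_sum (I J : finType) (inc : I -> J -> bool) (psi : {ffun I -> F^o}) :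
  {ffun J -> F^o} := [ffun j => \sum_(i | inc i j) psi i].

Lemma incidence_sum_is_linear (I J : finType) (inc : I -> J -> bool) :
  linear (incidence_sum inc).
Proof.
move=> a f g; apply/ffunP => j; rewrite !ffunE scaler_sumr -big_split /=.
by apply: eq_bigr => i _; rewrite !ffunE.
Qed.

HB.instance Definition _ (I J : finType) (inc : I -> J -> bool) :=
  GRing.isLinear.Build F {ffun I -> F^o} {ffun J -> F^o} _ (incidence_sum inc)
    (incidence_sum_is_linear inc).

Lemma dim_ffun (I : finType) : \dim {: {ffun I -> F^o}} = #|I|.
Proof. by rewrite dimvf /dim /= muln1. Qed.

Lemma incidence_sumE (I J : finType) (inc : I -> J -> bool) psi j :
  linfun (incidence_sum inc) psi j = \sum_(i | inc i j) psi i.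
Proof. by rewrite lfunE /= ffunE. Qed.

Lemma dim_le_determining (I : finType) (W : {vspace {ffun I -> F^o}}) (S : {set I}) :
  (forall psi, psi \in W -> {in S, psi =1 fun=> 0} -> psi = 0) -> (\dim W <= #|S|)%N.
Proof.
move=> det; pose f := linfun (incidence_sum (fun i (j : {i | i \in S}) => i == val j)).
have fE psi (j : {i | i \in S}) : f psi j = psi (val j).
  by rewrite incidence_sumE big_pred1_eq.
have <- : #|{: {i | i \in S}}| = #|S| by rewrite card_sig; apply: eq_card => i.
rewrite -dim_ffun -(@limg_dim_eq _ _ _ f W); first by apply/dimvS/subvf.
apply/eqP; rewrite -subv0; apply/subvP => psi; rewrite memv_cap memv_ker memv0.
move=> /andP[pW /eqP f0]; apply/eqP; apply: det => // i iS.
by have := fE psi (exist _ i iS); rewrite f0 ffunE.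
Qed.

(* Imposing one more vanishing condition lowers the dimension by exactly one. *)
Lemma exists_determining_subset (I : finType) (W : {vspace {ffun I -> F^o}}) (Z : {set I}) :
  (forall psi, psi \in W -> {in Z, psi =1 fun=> 0} -> psi = 0) ->
  exists S : {set I}, [/\ S \subset Z, #|S| = \dim W &
    forall psi, psi \in W -> {in S, psi =1 fun=> 0} -> psi = 0].
Proof.
have [d] := ubnP (\dim W); elim: d W Z => // d IH W Z ltd det.
have [W0|Wn0] := eqVneq (\dim W) 0%N.
  exists finset.set0; rewrite finset.sub0set cards0 W0; split=> // psi.
  by move/eqP: W0; rewrite dimv_eq0 => /eqP->; rewrite memv0 => /eqP.
pose psi0 := vpick W.
have psi0_neq0 : psi0 != 0 by rewrite vpick0 -dimv_eq0.
have [P PZ P0] : exists2 P, P \in Z & psi0 P != 0.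
  apply/exists_inP; apply: contraT; rewrite negb_exists_in => /forall_inP H.
  case/eqP: psi0_neq0; apply: det (memv_pick W) _ => P /H.
  by rewrite negbK => /eqP.
pose f := linfun (incidence_sum (fun i (j : unit) => i == P)).
have fE psi j : f psi j = psi P by rewrite incidence_sumE big_pred1_eq.
pose W' := (W :&: lker f)%VS.
have W'P psi : psi \in W' = (psi \in W) && (psi P == 0).
  rewrite memv_cap memv_ker; congr andb; apply/eqP/eqP => [E|E].
    by rewrite -(fE psi tt) E ffunE.
  by apply/ffunP => j; rewrite fE ffunE.
have dimW : (\dim W' + 1)%N = \dim W.
  rewrite -(limg_ker_dim f W); congr addn; apply/eqP; rewrite eq_sym eqn_leq.
  apply/andP; split; first by rewrite -[X in (_ <= X)%N]card_unit -dim_ffun dimvS ?subvf.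
  rewrite lt0n dimv_eq0 -lkerE; apply/negP => /subvP/(_ psi0 (memv_pick W)).
  rewrite memv_ker => /eqP/ffunP/(_ tt); rewrite fE ffunE => /eqP.
  by rewrite (negbTE P0).
have [||S [SZ cS dS]] := IH W' (Z :\ P).
- by rewrite -ltnS -dimW addn1 in ltd *.
- move=> psi; rewrite W'P => /andP[pW /eqP pP] pZ; apply: det => // Q QZ.
  by have [->//|QP] := eqVneq Q P; apply: pZ; rewrite !inE QP.
exists (P |: S); split.
- by rewrite finset.subUset finset.sub1set PZ (fintype.subset_trans SZ) // finset.subD1set.
- rewrite cardsU1 cS -dimW addnC; congr addn.
  by rewrite (_ : P \notin S) //; apply/negP => /(fintype.subsetP SZ); rewrite !inE eqxx.
- move=> psi pW pS; apply: dS => [|Q QS]; last by apply: pS; rewrite !inE QS orbT.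
  by rewrite W'P pW; apply/eqP/pS; rewrite !inE eqxx.
Qed.

(* The constraints are triangular, hence independent: the unknown [m j] occurs, apart from the
   constraint [j], only in constraints of larger height. *)
Lemma dim_triangular_constraints (I J : finType) (inc : I -> J -> bool)
    (m : J -> I) (h : J -> nat) :
  (forall j, inc (m j) j) ->
  (forall j j', inc (m j) j' -> j' = j \/ (h j < h j')%N) ->
  (\dim (lker (linfun (incidence_sum inc))) + #|J|)%N = #|I|.
Proof.
move=> inc_m tri; pose f := linfun (incidence_sum inc).
rewrite -(dim_ffun I) -(limg_ker_dim f fullv) capfv; congr addn.
(* [g] places the coefficient of [j] at the unknown [m j]. The square system [f \o g] is triangular,
   hence injective, so [f] is onto and the rank formula applies. *)
pose g := linfun (incidence_sum (fun (j : J) (i : I) => m j == i)).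
suff ker0 : lker (f \o g)%VF == 0%VS.
  rewrite -(dim_ffun J); apply/eqP; rewrite eqn_leq; apply/andP; split.
    by rewrite -(lker0_limgf ker0) limg_comp dimvS // limgS // subvf.
  by rewrite dimvS // subvf.
rewrite -subv0; apply/subvP => lam; rewrite memv_ker memv0 comp_lfunE => /eqP fg0.
have E j' : \sum_(j | inc (m j) j') lam j = 0.
  transitivity (f (g lam) j'); last by rewrite fg0 ffunE.
  rewrite incidence_sumE.
  rewrite (partition_big m (fun i => inc i j')) //=; apply: eq_bigr => i ij.
  rewrite incidence_sumE; apply: eq_bigl => j.
  by case: eqP => [->|_]; rewrite ?ij ?andbF.
apply/eqP/ffunP => j; rewrite ffunE.
have [n] := ubnP (h j); elim: n j => // n IH j hj.
have := E j; rewrite (bigD1 j) //= big1 ?addr0 // => i /andP[mi ij].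
have [ji|hi] := tri _ _ mi; first by rewrite ji eqxx in ij.
by apply: IH; apply: leq_trans hi _.
Qed.

End FunctionSpaces.

(** * Levels, counting and peaks *)

Section Levels.
Local Open Scope classical_set_scope.
Local Open Scope fset_scope.
Local Open Scope nat_scope.
Context {R : realType} {V : choiceType}.
Variables (K : set {fset V}) (black : {fset V} -> bool).
Hypothesis HK : is_H28 R K black.
Variables (o : V) (nbr : V -> nat -> V) (lev : V -> nat) (tp col : V -> bool).
Hypothesis CS : circular_structure K black o nbr lev tp col.
Implicit Types (u v w x y : V).

Local Notation adjacent := (adjacent K).
Local Notation ctri := (coloured_triangle K black).

Lemma circle_level_parent k b j : j < 8 -> circle_level k.+1 b j = k -> j <= b.
Proof. by rewrite /circle_level; do ?case: ifP => //; lia. Qed.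

Lemma adjacent_level u w : adjacent u w -> lev w <= (lev u).+1.
Proof.
move=> /(cs_surj CS)[j j8 ->]; rewrite (cs_level CS) //.
by rewrite /circle_level; case: (lev u) => // k; do ?case: ifP => //; lia.
Qed.

Lemma adjacent_level_cases u w : adjacent u w ->
  [\/ lev w = (lev u).+1, lev u = (lev w).+1 | lev u = lev w /\ 0 < lev u].
Proof.
move=> a; have h1 := adjacent_level a; have h2 := adjacent_level (adjacentC a).
have [h3|[h3|h3]] : lev w = (lev u).+1 \/ lev u = (lev w).+1 \/ lev u = lev w by lia.
- by constructor 1.
- by constructor 2.
- constructor 3; split=> //; rewrite lt0n; apply/eqP => u0.
  move: a h3 => /(cs_surj CS)[j j8 ->]; rewrite (cs_level CS) // u0.
  by [].
Qed.

Lemma consecutive_adjacent u j : j < 8 ->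
  [/\ adjacent u (nbr u j), adjacent u (nbr u ((j + 1) %% 8)) &
      adjacent (nbr u j) (nbr u ((j + 1) %% 8))].
Proof. by move=> j8; exact: (coloured_triangleP HK (cs_triangle CS u j8)). Qed.

Lemma coloured_triangle_consecutive k u w x : ctri k u w x ->
  exists2 j, j < 8 & k = col u (+) odd j /\
    ((w = nbr u j /\ x = nbr u ((j + 1) %% 8)) \/
     (x = nbr u j /\ w = nbr u ((j + 1) %% 8))).
Proof.
move=> T; have [a _ _] := coloured_triangleP HK T.
have [j j8 wj] := cs_surj CS a; rewrite {}wj in T *.
have [e|ne] := eqVneq k (col u (+) odd j).
  exists j => //; split=> //; left; split=> //.
  by rewrite e in T; exact: (coloured_triangle_unique HK T (cs_triangle CS u j8)).
pose i := (j + 7) %% 8.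
have i8 : i < 8 by rewrite ltn_mod.
have ij : (i + 1) %% 8 = j by rewrite /i; lia.
have oi : odd i = ~~ odd j by rewrite /i; lia.
have ek : k = col u (+) odd i.
  by rewrite oi; case: (k) (col u) (odd j) ne => -[] [].
exists i => //; split=> //; right; rewrite ij; split=> //.
have := coloured_triangleCr (cs_triangle CS u i8); rewrite -ek ij => T'.
exact: (coloured_triangle_unique HK T T').
Qed.

Definition ancestor u : V := iter (lev u) (nbr^~ 0) u.

Lemma level_parent u k : lev u = k.+1 -> adjacent u (nbr u 0) /\ lev (nbr u 0) = k.
Proof.
move=> uk; split; first exact: (cs_adjacent CS).
by rewrite (cs_level CS) // uk.
Qed.

(** Induction on the level: two parents of one vertex are adjacent one level lower, and adjacent
    vertices of the same level have a common parent. *)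
Lemma ancestor_adjacent u w : adjacent u w -> ancestor u = ancestor w.
Proof.
have [n] := ubnP (maxn (lev u) (lev w)); elim: n u w => // n IH.
have parent u p : lev u <= n -> adjacent u p -> lev u = (lev p).+1 ->
    ancestor u = ancestor p.
  move=> un a up; have [a0 l0] := level_parent up.
  have -> : ancestor u = ancestor (nbr u 0) by rewrite /ancestor up l0 iterSr.
  have [j j8 pj] := cs_surj CS a.
  have : j <= tp u.
    by apply: (@circle_level_parent (lev p)) => //; rewrite -up -(cs_level CS) // -pj.
  case: j => [|j] in j8 pj *; first by rewrite pj.
  case: j => [|j] in j8 pj *; last by case: (tp u).
  move=> _; apply: IH; first by rewrite l0; lia.
  by rewrite pj; have [_ _] := @consecutive_adjacent u 0 isT.
move=> u w; rewrite ltnS geq_max => /andP[un wn] a.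
have [e|e|[e u0]] := adjacent_level_cases a.
- by apply/esym/parent => //; apply: adjacentC.
- exact: parent.
have [p [ap aw]] : exists p, adjacent u p /\ (adjacent w p /\ (lev p).+1 = lev u).
  have [j j8 wj] := cs_surj CS a.
  case k: (lev u) u0 => [//|k'] _.
  have lj : circle_level k'.+1 (tp u) j = k'.+1 by rewrite -k -(cs_level CS) // -wj.
  have [j7|jb] : j = 7 \/ j = (tp u).+1.
    by move: lj; rewrite /circle_level; do ?case: ifP => //; lia.
    have [a7 a0 a70] := @consecutive_adjacent u 7 isT.
    exists (nbr u 0); split=> //; split; first by rewrite wj j7.
    by rewrite (cs_level CS) // k.
  have t8 : tp u < 8 by case: (tp u).
  have [b1 b2 b12] := @consecutive_adjacent u (tp u) t8.
  exists (nbr u (tp u)); split=> //; split.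
    by apply: adjacentC; rewrite wj jb; move: b12; case: (tp u).
  by rewrite (cs_level CS) // k /circle_level ltnSn.
have [aw' lp] := aw.
by rewrite (parent u p) // (parent w p) // -?e.
Qed.

Lemma level_eq0 u : lev u = 0 -> u = o.
Proof.
move=> u0; have := connected_const HK ancestor_adjacent u o.
by rewrite /ancestor u0 (cs_root CS).
Qed.

Lemma walk_rcons n u p v : walk K n u p -> edge K [fset p; v] -> walk K n.+1 u v.
Proof.
elim: n u => [|n IH] u /=; first by move=> -> e; exists v.
by move=> [w e wp] pv; exists w => //; exact: IH.
Qed.

Lemma walk_level n u v : walk K n u v -> lev v <= lev u + n.
Proof.
elim: n u => [|n IH] u /=; first by move=> ->; rewrite addn0.
move=> [w /adjacent_level uw /IH]; lia.
Qed.

Lemma walk_from_root v : walk K (lev v) o v.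
Proof.
move e: (lev v) => k; elim: k v e => [|k IH] v e; first by rewrite (level_eq0 e).
have [a l] := level_parent e; apply: walk_rcons (IH _ l) _.
exact: (adjacentC a).
Qed.

(** Levels grow by at most one along an edge, and descending through parents ends at [o], the only
    vertex of level zero. *)
Lemma at_distanceE v n : at_distance K o v n <-> lev v = n.
Proof.
have le m : walk K m o v -> lev v <= m by move=> /walk_level; rewrite (cs_root CS).
split=> [[w min]|<-]; last by split; [exact: walk_from_root|].
by apply/eqP; rewrite eqn_leq le // min //; exact: walk_from_root.
Qed.

Lemma in_disc r v : (v \in disc K o r) = (lev v <= r).
Proof.
rewrite /disc in_fset_set; last exact: finite_disc_set HK.
apply/idP/idP; rewrite inE /=.
  by move=> [n nr /at_distanceE ->].
by move=> vr; exists (lev v) => //; apply/at_distanceE.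
Qed.

Lemma in_boundary r v : (v \in boundary K o r) = (lev v == r).
Proof.
rewrite /boundary in_fset_set; last exact: finite_at_distance HK.
by apply/idP/eqP; rewrite inE /= at_distanceE.
Qed.

End Levels.

(** * Double counting of radial edges *)

Section Counting.
Local Open Scope classical_set_scope.
Local Open Scope fset_scope.
Local Open Scope nat_scope.
Context {R : realType} {V : choiceType}.
Variables (K : set {fset V}) (black : {fset V} -> bool).
Hypothesis HK : is_H28 R K black.
Variables (o : V) (nbr : V -> nat -> V) (lev : V -> nat) (tp col : V -> bool).
Hypothesis CS : circular_structure K black o nbr lev tp col.
Implicit Types (u v w x y p c : V).

Local Notation adjacent := (adjacent K).
Local Notation ctri := (coloured_triangle K black).
Local Notation third := (third K black).

Lemma parent_index c p : adjacent c p -> lev c = (lev p).+1 ->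
  exists2 i, i <= tp c & p = nbr c i.
Proof.
move=> a cp; have [i i8 pi] := cs_surj CS a; exists i => //.
by apply: (@circle_level_parent (lev p)) => //; rewrite -cp -(cs_level CS) // -pi.
Qed.

Lemma nbr_parent c i k : lev c = k.+1 -> i <= tp c ->
  adjacent c (nbr c i) /\ lev (nbr c i) = k.
Proof.
move=> ck ic; have i8 : i < 8 by move: ic; case: (tp c); lia.
split; first exact: (cs_adjacent CS).
by rewrite (cs_level CS) // ck /circle_level ltnS ic.
Qed.

Lemma distinct_parents c p q : adjacent c p -> adjacent c q ->
  lev c = (lev p).+1 -> lev c = (lev q).+1 -> p != q -> tp c.
Proof.
move=> ap aq cp cq pq; have [i ic pi] := parent_index ap cp.
have [j jc qj] := parent_index aq cq.
move: pq ic jc; rewrite pi qj; case: (tp c) => // ij.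
by rewrite !leqn0 => /eqP i0 /eqP j0; rewrite i0 j0 eqxx in ij.
Qed.

Lemma level1_one_parent c : lev c = 1 -> tp c = false.
Proof.
move=> c1; apply/negbTE/negP => tc.
have [a0 l0] := @nbr_parent c 0 0 c1 isT.
have [|a1 l1] := @nbr_parent c 1 0 c1; first by rewrite tc.
suff : 0 = 1 by [].
by apply: (cs_inj CS (u := c)) => //; rewrite (level_eq0 HK CS l0) (level_eq0 HK CS l1).
Qed.

Lemma consecutive_index k u w j : j < 8 -> ctri k u (nbr u j) w ->
  w = nbr u ((j + 1) %% 8) \/ w = nbr u ((j + 7) %% 8).
Proof.
move=> j8 /(coloured_triangle_consecutive HK CS)[i i8 [_ [[e1 e2]|[e1 e2]]]].
  by left; rewrite (cs_inj CS j8 i8 e1).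
right; have i18 : (i + 1) %% 8 < 8 by rewrite ltn_mod.
by rewrite e1 (cs_inj CS j8 i18 e2); congr nbr; lia.
Qed.

Lemma child_range p j : j < 8 -> 0 < lev p ->
  (lev (nbr p j) == (lev p).+1) = (tp p + 2 <= j <= 6).
Proof.
move=> j8; rewrite (cs_level CS) //; case: (lev p) => // k _.
by rewrite /circle_level; do ?case: ifP => //; lia.
Qed.

Lemma sibling_range p j : j < 8 -> 0 < lev p ->
  (lev (nbr p j) == lev p) = (j == tp p + 1) || (j == 7).
Proof.
move=> j8; rewrite (cs_level CS) //; case: (lev p) => // k _.
by rewrite /circle_level; do ?case: ifP => //; lia.
Qed.

(** The triangle formed by a child and its two parents contains [p] and a neighbour of [p] on its
    circle. So the child is next to such a neighbour around [p], which singles out the two ends of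
    the range of children. *)
Lemma child_two_parents p j : j < 8 -> 0 < lev p -> lev (nbr p j) = (lev p).+1 ->
  tp (nbr p j) = (j == tp p + 2) || (j == 6).
Proof.
move=> j8 p0 cj; have := child_range j8 p0; rewrite cj eqxx => /esym/andP[jlo jhi].
have apc := cs_adjacent CS p j8; have acp := adjacentC apc.
set c := nbr p j in cj apc acp *.
apply/idP/idP => [tc|].
  have [i ic pi] := parent_index acp cj.
  have i1 : i <= 1 by apply: leq_trans ic _; case: (tp c).
  have [|a1 l1] := @nbr_parent c (1 - i) _ cj; first by rewrite tc leq_subr.
  have T : ctri (col c) p c (nbr c (1 - i)).
    apply: coloured_triangleCl; have := cs_triangle CS c (isT : 0 < 8).
    rewrite addbF pi; case: (i) i1 => [|[|//]] // _ T; exact: coloured_triangleCr.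
  have [e|e] := consecutive_index j8 T; move/eqP: l1; rewrite e sibling_range ?ltn_mod //.
    by lia.
  by lia.
case/orP => /eqP ej.
  pose i := (j + 7) %% 8; have i8 : i < 8 by rewrite ltn_mod.
  have ij : (i + 1) %% 8 = j by rewrite /i; lia.
  have [ai _ aic] := consecutive_adjacent HK CS p i8; rewrite ij -/c in aic.
  have li : lev (nbr p i) = lev p.
    by apply/eqP; rewrite sibling_range //; rewrite /i ej; case: (tp p).
  apply: (distinct_parents acp (adjacentC aic)); rewrite ?li //.
  exact: adjacent_neq ai.
have [_ ai aic] := consecutive_adjacent HK CS p j8; rewrite -/c in aic.
have li : lev (nbr p ((j + 1) %% 8)) = lev p.
  by apply/eqP; rewrite sibling_range ?ltn_mod //; rewrite ej orbT.
apply: (distinct_parents acp aic); rewrite ?li //.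
exact: adjacent_neq ai.
Qed.

Definition radial p c := (p \in link K c) && (lev c == (lev p).+1).

Lemma radialP p c : reflect (adjacent c p /\ lev c = (lev p).+1) (radial p c).
Proof.
by apply: (iffP andP) => -[] => [/(in_link HK) a /eqP|a cp]; [|split; [apply/(in_link HK)|apply/eqP]].
Qed.

Lemma card_parents c r : 0 < lev c <= r ->
  #|` [fset p in disc K o r | radial p c]| = (tp c).+1.
Proof.
case k: (lev c) => [//|k'] /= kr.
have inP i : i <= tp c -> nbr c i \in [fset p in disc K o r | radial p c].
  move=> ic; have [a l] := nbr_parent k ic.
  rewrite !inE /= (in_disc HK CS) l (ltnW kr) /=; apply/radialP; split=> //.
  by rewrite k l.
have outP p : p \in [fset p in disc K o r | radial p c] -> exists2 i, i <= tp c & p = nbr c i.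
  by rewrite !inE /= => /andP[_ /radialP[a l]]; apply: parent_index.
case t: (tp c) in inP outP *; last first.
  rewrite (_ : [fset p in _ | _] = [fset nbr c 0]) ?cardfs1 //.
  apply/fsetP => p; rewrite [RHS]in_fset1; apply/idP/eqP => [/outP[[]//]|->].
  exact: inP.
rewrite (_ : [fset p in _ | _] = [fset nbr c 0; nbr c 1]).
  rewrite cardfs2; case: eqP => // e.
  by have := cs_inj CS (isT : 0 < 8) (isT : 1 < 8) e.
apply/fsetP => p; rewrite [RHS]in_fset2; apply/idP/orP.
  by move=> /outP[[|[|//]] _ ->]; [left|right].
by case=> /eqP ->; apply: inP.
Qed.

Lemma card_children_two_parents p r : 0 < lev p < r ->
  #|` [fset c in disc K o r | radial p c && tp c]| = 2.
Proof.
move=> /andP[p0 pr].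
have inC j : j < 8 -> (j == tp p + 2) || (j == 6) ->
    nbr p j \in [fset c in disc K o r | radial p c && tp c].
  move=> j8 jb.
  have l : lev (nbr p j) = (lev p).+1.
    apply/eqP; rewrite child_range //; move: jb; case: (tp p); lia.
  rewrite !inE /= (in_disc HK CS) l pr child_two_parents // jb andbT.
  by apply/radialP; split=> //; apply/adjacentC/(cs_adjacent CS).
rewrite (_ : [fset c in _ | _] = [fset nbr p (tp p + 2); nbr p 6]).
  rewrite cardfs2; case: eqP => // e.
  by have := cs_inj CS _ _ e; case: (tp p) => /(_ isT isT).
apply/fsetP => c; rewrite [RHS]in_fset2; apply/idP/orP; last first.
  by case=> /eqP ->; apply: inC; rewrite ?eqxx ?orbT //; case: (tp p).
rewrite !inE /= => /and3P[_ /radialP[a l] tc].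
have [j j8 cj] := cs_surj CS (adjacentC a).
have l' : lev (nbr p j) = (lev p).+1 by rewrite -cj.
by move: tc; rewrite cj child_two_parents // => /orP[]/eqP->; [left|right].
Qed.

Lemma no_children_two_parents p r : ~~ (0 < lev p < r) ->
  #|` [fset c in disc K o r | radial p c && tp c]| = 0.
Proof.
move=> pr; apply/eqP; rewrite cardfs_eq0; apply/eqP/fsetP => c.
rewrite !inE /=; apply/negP => /and3P[cr /radialP[a l] tc].
rewrite (in_disc HK CS) in cr; case/negP: pr.
rewrite lt0n; apply/andP; split; last by rewrite -l.
by apply/negP => /eqP p0; rewrite p0 in l; rewrite level1_one_parent in tc.
Qed.

(** Exactly one edge of a triangle runs along a circle. The six terms test both directions of each
    edge, and the proof goes through the eight sectors at [u]. *)
Lemma radial_pairs_of_triangle k u w x : ctri k u w x ->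
  (lev u == (lev w).+1) + (lev w == (lev u).+1) + (lev u == (lev x).+1) +
  (lev x == (lev u).+1) + (lev w == (lev x).+1) + (lev x == (lev w).+1) = 2.
Proof.
move=> /(coloured_triangle_consecutive HK CS)[j j8 [_ H]].
have l1 := cs_level CS u j8.
have j18 : (j + 1) %% 8 < 8 by rewrite ltn_mod.
have l2 := cs_level CS u j18.
have {H} : (lev w = circle_level (lev u) (tp u) j /\
    lev x = circle_level (lev u) (tp u) ((j + 1) %% 8)) \/
  (lev x = circle_level (lev u) (tp u) j /\
    lev w = circle_level (lev u) (tp u) ((j + 1) %% 8)).
  by case: H => -[-> ->]; [left|right].
case: (lev u) => [|k']; first by case=> -[-> ->].
move: j j8 {j18 l1 l2}; do 8 (case=> [_|]; first by
  case: (tp u); rewrite /circle_level /=; case=> -[-> ->]; lia).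
by [].
Qed.

Lemma in_black_triangles (D : {fset V}) t :
  (t \in black_triangles K black D) <-> [/\ triangle K t, black t & t `<=` D].
Proof.
by rewrite /black_triangles in_fset_set ?inE //; exact: finite_black_triangles.
Qed.

Lemma sum_fset3 (u w x : V) (f : V -> nat) : u != w -> u != x -> w != x ->
  \sum_(v <- [fset u; w; x]) f v = f u + f w + f x.
Proof.
move=> uw ux wx; rewrite fsetUC big_fsetU1 /=; last first.
  by rewrite !inE negb_or ![x == _]eq_sym ux wx.
by rewrite big_fsetU1 /= ?inE // big_seq_fset1; lia.
Qed.

Lemma sum_fset_sep (D t : {fset V}) (f : V -> nat) : t `<=` D ->
  \sum_(v <- D) (v \in t) * f v = \sum_(v <- t) f v.
Proof.
move=> tD; transitivity (\sum_(v <- t) (v \in t) * f v).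
  by apply/esym/(big_fset_incl _ tD) => v _ /negbTE ->.
by rewrite big_seq [RHS]big_seq; apply: eq_bigr => v ->; rewrite mul1n.
Qed.

(* Each radial edge lies in exactly one black triangle and each black triangle has two of them. *)
Lemma card_black_triangles_radial r :
  2 * #|` black_triangles K black (disc K o r)| =
  \sum_(c <- disc K o r) \sum_(p <- disc K o r) radial p c.
Proof.
set D := disc K o r; set B := black_triangles K black D.
have inD v : (v \in D) = (lev v <= r) := in_disc HK CS r v.
transitivity (\sum_(t <- B) \sum_(c <- D) \sum_(p <- D)
    (c \in t) * ((p \in t) * radial p c)).
  transitivity (\sum_(t <- B) 2); first by rewrite big_const_seq count_predT iter_addn_0.
  rewrite big_seq [RHS]big_seq; apply: eq_bigr => t /in_black_triangles[Tt bt tD].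
  under eq_bigr do rewrite -big_distrr /= sum_fset_sep //.
  rewrite sum_fset_sep //.
  have [Kt t3] := Tt.
  have [u ut] : exists u, u \in t by apply/fset0Pn; rewrite -cardfs_gt0 t3.
  have [w] : exists w, w \in t `\ u.
    by apply/fset0Pn; rewrite -cardfs_gt0; move: t3; rewrite (cardfsD1 u) ut add1n => -[->].
  rewrite in_fsetD1 => /andP[wu wt]; rewrite eq_sym in wu.
  have [x tx] := triangle_third t3 ut wt wu.
  have T : ctri true u w x by split; rewrite -?tx.
  have [auw aux awx] := coloured_triangleP HK T.
  have [uw ux wx] := And3 (adjacent_neq auw) (adjacent_neq aux) (adjacent_neq awx).
  have rad a b : adjacent a b -> radial b a = (lev a == (lev b).+1).
    by move=> ab; apply/radialP/eqP => [[]|].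
  have rad0 a : radial a a = false.
    by apply/radialP => -[/adjacent_neq]; rewrite eqxx.
  have [awu axu axw] := And3 (adjacentC auw) (adjacentC aux) (adjacentC awx).
  rewrite tx !sum_fset3 // !rad0 !rad //.
  by rewrite -(radial_pairs_of_triangle T); lia.
rewrite exchange_big /= big_seq [RHS]big_seq; apply: eq_bigr => c cD.
rewrite exchange_big /= big_seq [RHS]big_seq; apply: eq_bigr => p pD.
case: (boolP (radial p c)) => [/radialP[a cp]|_]; last first.
  by rewrite big1 // => t _; rewrite !muln0.
under eq_bigr do rewrite muln1 mulnb.
rewrite -cardfs_sep (_ : [fset t in B | _] = [fset [fset p; c; third true p c]]) ?cardfs1 //.
have T := third_triangle HK true (adjacentC a).
set x := third true p c in T *.
have [apc apx acx] := coloured_triangleP HK T.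
apply/fsetP => t; rewrite [RHS]in_fset1 !inE /=; apply/idP/eqP.
  move=> /andP[/in_black_triangles[[Kt t3] bt _] /andP[ct pt]].
  have [y ty] := triangle_third t3 pt ct (adjacent_neq apc).
  have T' : ctri true p c y by split; rewrite -?ty.
  by rewrite ty (coloured_triangle_unique HK T T').
move=> ->; rewrite !inE !eqxx ?orbT /= andbT; apply/in_black_triangles.
case: T => Tt bt; split=> //; apply/fsubsetP => v; rewrite !inE.
have lx := adjacent_level CS apx.
by move=> /orP[/orP[]|]/eqP-> //; rewrite inD (leq_trans lx) // -cp -inD.
Qed.

(** The radial edges number one for each vertex other than [o], plus one more for each vertex with
    two parents. The latter are as many as the vertices strictly between the root and the
    boundary. *)
Lemma card_disc_boundary r :
  2 * #|` black_triangles K black (disc K o r.+1)| + #|` boundary K o r.+1| + 2 =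
  2 * #|` disc K o r.+1|.
Proof.
rewrite card_black_triangles_radial; set D := disc K o r.+1.
have inD v : (v \in D) = (lev v <= r.+1) := in_disc HK CS r.+1 v.
pose b c := (0 < lev c) && tp c.
have sum_parents c : c \in D ->
    \sum_(p <- D) radial p c = (0 < lev c) + b c.
  rewrite inD -cardfs_sep /b => cr; case: (posnP (lev c)) => [c0|c0] /=.
    apply/eqP; rewrite cardfs_eq0; apply/eqP/fsetP => p; rewrite !inE /=.
    by apply/negP => /andP[_ /radialP[_]]; rewrite c0.
  by rewrite card_parents ?c0.
rewrite (eq_big_seq _ sum_parents) big_split /=.
have D0 : \sum_(c <- D) (lev c == 0) = 1.
  rewrite -cardfs_sep (_ : [fset c in D | _] = [fset o]) ?cardfs1 //.
  apply/fsetP => c; rewrite [RHS]in_fset1 !inE /= inD; apply/andP/eqP.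
    by move=> [_ /eqP]; exact: (level_eq0 HK CS).
  by move=> ->; rewrite (cs_root CS).
have Dr : \sum_(c <- D) (lev c == r.+1) = #|` boundary K o r.+1|.
  rewrite -cardfs_sep; congr (#|` _|); apply/fsetP => c.
  rewrite !inE /= inD (in_boundary HK CS); case: eqP => [->|]; rewrite ?andbF //.
  by rewrite leqnn.
have cardD : #|` D| = \sum_(c <- D) (0 < lev c) + 1.
  rewrite -[X in _ + X]D0 -big_split card_fset_sum1; apply: eq_bigr => c _ /=.
  by case: (lev c) => [|k]; rewrite /= ?addn0.
(* Pairs of a parent and a two-parent child: such a child has two parents, and each vertex strictly
   between the root and the boundary has two such children. *)
have sum_b : 2 * \sum_(c <- D) b c = 2 * \sum_(p <- D) (0 < lev p < r.+1).
  transitivity (\sum_(c <- D) \sum_(p <- D) (radial p c && tp c)).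
    rewrite big_distrr /=; apply: eq_big_seq => c cD.
    have := sum_parents c cD; rewrite /b; case: (tp c) => E; last first.
      by rewrite andbF big1 // => p _; rewrite andbF.
    under eq_bigr do rewrite andbT.
    by rewrite E andbT; lia.
  rewrite exchange_big /= big_distrr /=; apply: eq_big_seq => p pD.
  rewrite -cardfs_sep; case: (boolP (0 < lev p < r.+1)) => H.
    by rewrite card_children_two_parents.
  by rewrite no_children_two_parents.
have cardD' : \sum_(c <- D) (0 < lev c) =
    \sum_(p <- D) (0 < lev p < r.+1) + #|` boundary K o r.+1|.
  rewrite -Dr -big_split; apply: eq_big_seq => c /=; rewrite inD.
  by case: (lev c) => // k; rewrite ltnS leq_eqVlt => /orP[/eqP->|]; lia.
by lia.
Qed.

End Counting.

(** * Vertices that make the constraints triangular *)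

Section Peaks.
Local Open Scope classical_set_scope.
Local Open Scope fset_scope.
Local Open Scope nat_scope.
Context {R : realType} {V : choiceType}.
Variables (K : set {fset V}) (black : {fset V} -> bool).
Hypothesis HK : is_H28 R K black.
Variables (o : V) (nbr : V -> nat -> V) (lev : V -> nat) (tp col : V -> bool).
Hypothesis CS : circular_structure K black o nbr lev tp col.
Implicit Types (u v w x y p c : V).

Local Notation adjacent := (adjacent K).
Local Notation ctri := (coloured_triangle K black).

(** The children with two parents sit at both ends of the range of children, three or four positions
    apart. *)
Lemma siblings_one_parent k p c c' : ctri k p c c' ->
  lev c = (lev p).+1 -> lev c' = (lev p).+1 -> tp c -> tp c' = false.
Proof.
move=> T cp c'p tc; apply/negbTE/negP => tc'.
have [p0|p0] := posnP (lev p).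
  by rewrite (level1_one_parent HK CS) // cp p0 in tc.
have [apc _ _] := coloured_triangleP HK T.
have [j j8 cj] := cs_surj CS apc; rewrite {}cj in T cp tc.
rewrite (child_two_parents HK CS) // in tc.
have b1 : tp p <= 1 by case: (tp p).
have [e|e] := consecutive_index HK CS j8 T; rewrite e in c'p tc';
  rewrite (child_two_parents HK CS) ?ltn_mod // in tc'; lia.
Qed.

Lemma inner_index c j : j < 8 -> 0 < lev c -> lev (nbr c j) <= lev c ->
  lev (nbr c ((j + 1) %% 8)) <= lev c -> j = 7 \/ j <= tp c.
Proof.
move=> j8 c0; have j18 : (j + 1) %% 8 < 8 by rewrite ltn_mod.
have := child_range CS j8 c0; have := child_range CS j18 c0.
have := adjacent_level CS (cs_adjacent CS c j8).
have := adjacent_level CS (cs_adjacent CS c j18).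
have b1 : tp c <= 1 by case: (tp c).
by lia.
Qed.

Lemma level_neighbour_gt0 c w : adjacent c w -> lev w <= lev c -> 0 < lev c.
Proof.
move=> /(cs_surj CS)[j j8 ->]; rewrite (cs_level CS) // lt0n => H.
by apply/eqP => c0; rewrite c0 in H.
Qed.

(** The sectors at [c] staying within its level are 7 and 0, and also 1 if [c] has two parents.
    Colours alternate, so the first case has one sector of each colour; in the second, sector 0,
    spanned by the parents, is alone of its colour. *)
Lemma peak_unique k c w x y z : ctri k c w x -> ctri k c y z ->
  lev w <= lev c -> lev x <= lev c -> lev y <= lev c -> lev z <= lev c ->
  ~~ tp c \/ (lev w < lev c /\ lev x < lev c) -> [fset c; y; z] = [fset c; w; x].
Proof.
move=> T T' lw lx ly lz top.
have [aw _ _] := coloured_triangleP HK T.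
have c0 := level_neighbour_gt0 aw lw.
have b1 : tp c <= 1 by case: (tp c).
have [i i8 [ki Hi]] := coloured_triangle_consecutive HK CS T.
have [j j8 [kj Hj]] := coloured_triangle_consecutive HK CS T'.
have oij : odd i = odd j by move: ki; rewrite kj; case: (col c) (odd i) (odd j) => -[] [].
have ii : i = 7 \/ i <= tp c.
  by apply: inner_index => //; case: Hi => -[e1 e2]; rewrite -?e1 -?e2.
have jj : j = 7 \/ j <= tp c.
  by apply: inner_index => //; case: Hj => -[e1 e2]; rewrite -?e1 -?e2.
have ij : j = i.
  have [tc|tc] := boolP (tp c); last by rewrite (negbTE tc) in ii jj; lia.
  have [//|[lw' lx']] : ~~ tp c \/ lev w < lev c /\ lev x < lev c := top.
    by rewrite tc.
  have low m : m < 8 -> lev (nbr c m) < lev c -> m <= 1.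
    move=> m8; have := sibling_range CS m8 c0; have := child_range CS m8 c0.
    rewrite (cs_level CS) //; move: c0; rewrite tc.
    case: (lev c) => // k' _; rewrite /circle_level; do ?case: ifP => //; lia.
  have i1 : i <= 1 by apply: low => //; case: Hi => -[<- _].
  have i18 : (i + 1) %% 8 < 8 by rewrite ltn_mod.
  have i2 : (i + 1) %% 8 <= 1 by apply: low => //; case: Hi => -[_ <-].
  by rewrite tc in jj; lia.
have swap a b : [fset c; a; b] = [fset c; b; a] by rewrite -!fsetUA [in X in _ = X](fsetUC [fset b]).
rewrite ij in Hj.
by case: Hi => -[-> ->]; case: Hj => -[-> ->] //; exact: swap.
Qed.

(** A highest vertex works unless it has two parents and the triangle is not the one they span. The
    triangle then contains a neighbour on the same circle and a common parent, and that neighbour,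
    having one parent, works instead. *)
Lemma exists_peak t : triangle K t -> black t ->
  exists c, [/\ c \in t, forall v, v \in t -> lev v <= lev c &
    forall t', triangle K t' -> black t' -> c \in t' ->
      (forall v, v \in t' -> lev v <= lev c) -> t' = t].
Proof.
move=> Tt bt; have [Kt t3] := Tt.
have other s c : #|` s| = 3 -> c \in s -> exists w x, [/\ w != c & s = [fset c; w; x]].
  move=> s3 cs; have [w] : exists w, w \in s `\ c.
    by apply/fset0Pn; rewrite -cardfs_gt0; move: s3; rewrite (cardfsD1 c) cs add1n => -[->].
  rewrite in_fsetD1 => /andP[wc ws].
  have cw : c != w by rewrite eq_sym.
  have [x sx] := triangle_third s3 cs ws cw.
  by exists w, x.
have good c w x : t = [fset c; w; x] -> lev w <= lev c -> lev x <= lev c ->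
    ~~ tp c \/ (lev w < lev c /\ lev x < lev c) ->
    exists c, [/\ c \in t, forall v, v \in t -> lev v <= lev c &
    forall t', triangle K t' -> black t' -> c \in t' ->
      (forall v, v \in t' -> lev v <= lev c) -> t' = t].
  move=> tE lw lx top; exists c; split.
  - by rewrite tE !inE eqxx.
  - by move=> v; rewrite tE !inE => /orP[/orP[]|]/eqP->.
  move=> t' Tt' bt' ct' low.
  have [y [z [yc t'E]]] := other t' c Tt'.2 ct'.
  have T : ctri true c w x by split; rewrite -tE.
  have T' : ctri true c y z by split; rewrite -t'E.
  rewrite t'E tE; apply: (peak_unique T T') => //; apply: low; rewrite t'E !inE eqxx ?orbT //.
have [c [ct cmax]] : exists c, c \in t /\ forall v, v \in t -> lev v <= lev c.
  have [u ut] : exists u, u \in t by apply/fset0Pn; rewrite -cardfs_gt0 t3.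
  have [w [x [_ tE]]] := other t u t3 ut.
  have mem3 a : a = u \/ a = w \/ a = x -> a \in t.
    by rewrite tE !inE => -[->|[->|->]]; rewrite eqxx ?orbT.
  have max3 a : lev u <= lev a -> lev w <= lev a -> lev x <= lev a ->
      forall v, v \in t -> lev v <= lev a.
    by move=> h1 h2 h3 v; rewrite tE !inE => /orP[/orP[]|]/eqP->.
  have [h|[h|h]] : (lev w <= lev u /\ lev x <= lev u) \/
      ((lev u <= lev w /\ lev x <= lev w) \/ (lev u <= lev x /\ lev w <= lev x)) by lia.
  - by exists u; split; [apply: mem3; left|apply: max3; case: h].
  - by exists w; split; [apply: mem3; right; left|apply: max3; case: h].
  - by exists x; split; [apply: mem3; right; right|apply: max3; case: h].
have [w0 [x0 [_ tE0]]] := other t c t3 ct.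
have T0 : ctri true c w0 x0 by split; rewrite -tE0.
have [j j8 [kj Hj]] := coloured_triangle_consecutive HK CS T0.
have tE : t = [fset c; nbr c j; nbr c ((j + 1) %% 8)].
  rewrite tE0; case: Hj => -[-> ->] //.
  by rewrite -!fsetUA [in X in _ = X](fsetUC [fset nbr c j]).
have lw : lev (nbr c j) <= lev c by apply: cmax; rewrite tE !inE eqxx ?orbT.
have lx : lev (nbr c ((j + 1) %% 8)) <= lev c by apply: cmax; rewrite tE !inE eqxx ?orbT.
have c0 := level_neighbour_gt0 (cs_adjacent CS c j8) lw.
have [tc|tc] := boolP (tp c); last by apply: (good c _ _ tE) => //; left.
have T := cs_triangle CS c j8.
have [c' ck] : exists k, lev c = k.+1 by case: (lev c) c0 => // k _; exists k.
have lv i : i < 8 -> lev (nbr c i) = circle_level c'.+1 true i.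
  by move=> i8; rewrite (cs_level CS) // ck tc.
have [j7|j1] := inner_index j8 c0 lw lx.
  rewrite j7 in tE T.
  have l7 : lev (nbr c 7) = c'.+1 by rewrite lv.
  have l0 : lev (nbr c 0) = c' by rewrite lv.
  apply: (good (nbr c 7) c (nbr c 0)); rewrite ?l7 ?l0 ?ck //.
    by rewrite tE (fsetUC [fset c]).
  left; apply/negbT; have T' : ctri (col c (+) odd 7) (nbr c 0) c (nbr c 7).
    exact/coloured_triangleCl/coloured_triangleCr.
  by apply: (siblings_one_parent T'); rewrite ?l7 ?l0 ?ck.
rewrite tc in j1; case: j => [|[|//]] in j1 tE T {j8 kj Hj lw lx} *.
  by apply: (good c _ _ tE); rewrite ?lv ?ck //; right.
have l1 : lev (nbr c 1) = c' by rewrite lv.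
have l2 : lev (nbr c 2) = c'.+1 by rewrite lv.
apply: (good (nbr c 2) c (nbr c 1)); rewrite ?l1 ?l2 ?ck //.
  by rewrite tE [LHS]fsetUC [LHS]fsetUA.
left; apply/negbT; have T' : ctri (col c (+) odd 1) (nbr c 1) c (nbr c 2).
  exact: coloured_triangleCl.
by apply: (siblings_one_parent T'); rewrite ?l1 ?l2 ?ck.
Qed.

(** The positions 3, 4 and 5 always hold children, and one of the two sectors between them is
    black. *)
Lemma exists_outer_black v : exists y z,
  [/\ ctri true v y z, lev y = (lev v).+1 & lev z = (lev v).+1].
Proof.
have out j : 3 <= j <= 5 -> lev (nbr v j) = (lev v).+1.
  move=> j35; rewrite (cs_level CS); last by lia.
  by rewrite /circle_level; case: (lev v) => // k; case: (tp v); do ?case: ifP => //; lia.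
case E: (col v).
  by exists (nbr v 4), (nbr v 5); rewrite !out //; have := cs_triangle CS v (isT : 4 < 8); rewrite E.
by exists (nbr v 3), (nbr v 4); rewrite !out //; have := cs_triangle CS v (isT : 3 < 8); rewrite E.
Qed.

End Peaks.

Theorem mainTheorem2 (R : realType) (V : choiceType) (K : set {fset V})
    (black : {fset V} -> bool) (HK : is_H28 R K black) (o : V) (r : nat) :
  let D := disc K o r.+1 in
  let dD := boundary K o r.+1 in
  let B := black_triangles K black D in
  [/\ #|` D|%:R - #|` B|%:R = #|` dD|%:R / 2 + 1 :> rat,
      exists W : {vspace {ffun D -> R^o}},
        (forall psi, psi \in W <-> d_holomorphic K black psi) /\
        (\dim W)%:R = #|` dD|%:R / 2 + 1 :> rat,
      exists S : {fset V},
        [/\ (S `<=` dD)%fset, #|` S|%:R = #|` dD|%:R / 2 + 1 :> rat &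
            determining R K black D S] &
      forall S : {fset V}, (S `<=` dD)%fset -> determining R K black D S ->
        #|` dD|%:R / 2 + 1 <= #|` S|%:R :> rat].
Proof.
move=> D dD B.
have [nbr [lev [tp [col CS]]]] := exists_circular_structure HK o.
have inD v : (v \in D) = (lev v <= r.+1)%N := in_disc HK CS r.+1 v.
have indD v : (v \in dD) = (lev v == r.+1) := in_boundary HK CS r.+1 v.
have BP t : (t \in B) <-> [/\ triangle K t, black t & (t `<=` D)%fset].
  exact: in_black_triangles.
have count : (2 * #|` B| + #|` dD| + 2 = 2 * #|` D|)%N := card_disc_boundary HK CS r.
pose inc (P : D) (t : B) := val P \in val t.
have /boolp.choice[pk Hpk] : forall t : B, exists P : D,
    [/\ val P \in val t, forall v, v \in val t -> (lev v <= lev (val P))%N &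
     forall t', triangle K t' -> black t' -> val P \in t' ->
      (forall v, v \in t' -> (lev v <= lev (val P))%N) -> t' = val t].
  move=> t; have /BP[Tt bt tD] := valP t.
  have [c [ct cmax cuniq]] := exists_peak HK CS Tt bt.
  by exists [` fsubsetP tD _ ct]%fset.
pose W := lker (linfun (@incidence_sum R _ _ inc)).
have WP psi : psi \in W <-> d_holomorphic K black psi.
  rewrite memv_ker; split=> [/eqP/ffunP H t Tt bt tD|H].
    have tB : t \in B by apply/BP.
    have E : \sum_(P | inc P [` tB]%fset) psi P = 0.
      by rewrite -incidence_sumE H ffunE.
    by rewrite -[RHS]E; apply: eq_bigl.
  apply/eqP/ffunP => t; rewrite incidence_sumE [RHS]ffunE.
  by have /BP[Tt bt tD] := valP t; apply: H.
have dimW : (\dim W + #|` B|)%N = #|` D|.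
  rewrite [in RHS]cardfE [#|` B|]cardfE.
  apply: (dim_triangular_constraints (m := pk) (h := fun t => lev (val (pk t)))) => [t|t t' mt].
    by rewrite /inc; case: (Hpk t).
  have [_ _ un] := Hpk t; have [_ max' _] := Hpk t'.
  have /BP[Tt' bt' _] := valP t'.
  (* If the peak of [t'] is no higher than that of [t], then all of [t'] lies within the level of
     the peak of [t], whose uniqueness gives [t' = t]. *)
  case: (ltnP (lev (val (pk t))) (lev (val (pk t')))) => [|le]; [by right|left].
  apply/val_inj/un => // v /max' H; exact: leq_trans H le.
have dimE : (2 * \dim W = #|` dD| + 2)%N by lia.
have dimQ : (\dim W)%:R = #|` dD|%:R / 2 + 1 :> rat.
  have : (2 * \dim W)%:R = (#|` dD| + 2)%:R :> rat by rewrite dimE.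
  by rewrite natrM natrD; lra.
have detdD psi : psi \in W ->
    {in [set P : D | val P \in dD]%SET, psi =1 fun=> 0} -> psi = 0.
  move=> /WP hpsi bd; apply/ffunP => P; rewrite [RHS]ffunE.
  (* Induction inwards from the boundary: in an outer black triangle the two farther values vanish,
     hence so does the value at [P]. *)
  have [n] := ubnP (r.+1 - lev (val P))%N; elim: n P => // n IH P hP.
  have [lP|lP] := eqVneq (lev (val P)) r.+1.
    by apply: bd; rewrite inE indD lP.
  have ltP : (lev (val P) <= r)%N by have := valP P; rewrite inD; lia.
  have [y [z [[Tt bt] ly lz]]] := exists_outer_black CS (val P).
  set t := [fset _; _; _]%fset in Tt bt.
  have tD : (t `<=` D)%fset.
    apply/fsubsetP => v; rewrite !inE.
    by move=> /orP[/orP[]|]/eqP->; rewrite inD ?ly ?lz //; apply: leq_trans ltP _.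
  have := hpsi t Tt bt tD; rewrite (bigD1 P) /=; last by rewrite !inE eqxx.
  rewrite big1 ?addr0 // => Q /andP[Qt QP]; apply: IH.
  have -> : lev (val Q) = (lev (val P)).+1.
    move: Qt; rewrite !inE => /orP[/orP[]|]/eqP E; last 2 first.
    - by rewrite /= E.
    - by rewrite /= E.
    by case/eqP: QP; apply: val_inj.
  lia.
have detW (S : {fset V}) : determining R K black D S <->
    forall psi, psi \in W -> {in [set P : D | val P \in S]%SET, psi =1 fun=> 0} -> psi = 0.
  split=> [det psi pW p0|det psi phi hpsi hphi e].
    apply: det; [exact/WP|by apply/WP; rewrite mem0v|].
    by move=> P PS; rewrite p0 ?inE // ffunE.
  apply/eqP; rewrite -subr_eq0; apply/eqP/det.
    by apply: rpredB; apply/WP.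
  by move=> P; rewrite inE => PS; rewrite !ffunE e // subrr.
split.
- by rewrite -dimQ -dimW natrD addrK.
- by exists W; split.
- have [S0 [S0Z cS0 det0]] := exists_determining_subset detdD.
  exists [fset val P | P in S0]%fset; split.
  + apply/fsubsetP => v /imfsetP[P /= PS ->].
    by have := fintype.subsetP S0Z _ PS; rewrite inE.
  + rewrite card_imfset /=; last exact: val_inj.
    by rewrite -cardE cS0.
  apply/detW => psi pW p0; apply: det0 => // P PS; apply: p0.
  by rewrite inE; apply/imfsetP; exists P.
move=> S SdD /detW det; rewrite -dimQ ler_nat.
apply: leq_trans (dim_le_determining det) _.
set S0 := [set P : D | _]%SET.
have -> : #|S0| = #|` [fset val P | P in S0]%fset|.
  by rewrite card_imfset /= -?cardE //; exact: val_inj.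
by apply/fsubset_leq_card/fsubsetP => v /imfsetP[P /= + ->]; rewrite inE.
Qed.
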